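(* Let $p\in[1,\infty)$ and let $A$ be a nondegenerate $L^p$-operator algebra with a contractive approximate identity (cai). If $(\alpha,\sigma)$ and $(\beta,\omega)$ are exterior equivalent twisted actions of a locally compact second countable group $G$ on $A$, then $F^p(G,A,\alpha,\sigma)$ is isometrically isomorphic to $F^p(G,A,\beta,\omega)$.
   Context: A cai of $A$ is a net $(e_\lambda)$ with $\|e_\lambda\|\le1$, $\|e_\lambda a-a\|\to0$, $\|ae_\lambda-a\|\to0$ for all $a$. A representation of $A$ on a Banach space $E$ is a bounded algebra homomorphism $\pi:A\to\mathcal{B}(E)$; contractive if $\|\pi\|\le1$; nondegenerate if $\mathrm{span}\{\pi(a)\xi\}$ is dense in $E$. $A$ is a nondegenerate $L^p$-operator algebra if it has an isometric nondegenerate representation on some $L^p(\mu)$. $M(A)$ is the multiplier algebra (double centralizers), containing $A$ isometrically as a closed two-sided ideal. A nondegenerate representation $\pi$ of $A$ on $E$ extends uniquely to a unital representation $\widehat\pi:M(A)\to\mathcal{B}(E)$. $\mathrm{Aut}(A)$ is the group of isometric automorphisms of $A$ (extended canonically to $M(A)$); $\mathrm{Inv}_1(M(A))$ is the group of invertible $u\in M(A)$ with $\|u\|=\|u^{-1}\|=1$; $\mathrm{Ad}(u)a=uau^{-1}$; $\mathrm{Iso}(E)$ is the group of invertible isometries of $E$. A twisted action $(\alpha,\sigma)$ of $G$ on $A$ is a pair of maps $\alpha:G\to\mathrm{Aut}(A)$, $\sigma:G\times G\to\mathrm{Inv}_1(M(A))$ such that: $x\mapsto\alpha_x(a)$ is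 continuous for each $a\in A$; $(x,y)\mapsto\sigma_{x,y}a$ and $(x,y)\mapsto a\sigma_{x,y}$ are continuous $G\times G\to A$ for each $a\in A$; $\alpha_{1_G}=\mathrm{id}_A$; $\sigma_{1_G,x}=\sigma_{x,1_G}=1_{M(A)}$; $\alpha_x\alpha_y=\mathrm{Ad}(\sigma_{x,y})\circ\alpha_{xy}$; $\alpha_z(\sigma_{x,y})\sigma_{z,xy}=\sigma_{z,x}\sigma_{zx,y}$ for all $x,y,z\in G$. Twisted actions $(\alpha,\sigma)$ and $(\beta,\omega)$ of $G$ on $A$ are exterior equivalent if there is $\theta:G\to\mathrm{Inv}_1(M(A))$ such that: $x\mapsto\theta_xa$ and $x\mapsto a\theta_x$ are continuous $G\to A$ for all $a\in A$; $\beta_x=\mathrm{Ad}(\theta_x)\circ\alpha_x$ for all $x\in G$; $\omega_{x,y}\theta_{xy}=\theta_x\alpha_x(\theta_y)\sigma_{x,y}$ for all $x,y\in G$. $L^1(G,A,\alpha,\sigma)$ is $L^1(G;A)$ (Bochner integrable functions for a left Haar measure $dx$) with product $(f*_{\alpha,\sigma}g)(x)=\int_G f(y)\alpha_y(g(y^{-1}x))\sigma_{y,y^{-1}x}\,dy$. A covariant representation of $(G,A,\alpha,\sigma)$ on $E$ is a pair $(\pi,u)$ with $\pi$ a nondegenerate representation of $A$ on $E$ and $u:G\to\mathrm{Iso}(E)$ strongly continuous, with $u_xu_y=\widehat\pi(\sigma_{x,y})u_{xy}$ and $\pi(\alpha_x(a))=u_x\pi(a)u_x^{-1}$; it is contractive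 if $\pi$ is. Put $(\pi\rtimes u)(f)=\int_G\pi(f(x))u_x\,dx$. Let $\mathcal{R}^p$ be the class of all contractive covariant representations of $(G,A,\alpha,\sigma)$ on spaces $L^p(\mu)$ with $\mu$ $\sigma$-finite. The full $L^p$-twisted crossed product $F^p(G,A,\alpha,\sigma)$ is the Hausdorff completion of $L^1(G,A,\alpha,\sigma)$ in the seminorm $\|f\|=\sup\{\|(\pi\rtimes u)(f)\|:(\pi,u)\in\mathcal{R}^p\}$. *)

(* Defs.v *)
From HB Require Import structures.
From mathcomp Require Import all_boot all_order all_algebra.
From mathcomp Require Import complex.
From mathcomp Require Import all_classical all_reals all_analysis.

Set Implicit Arguments.
Unset Strict Implicit.
Unset Printing Implicit Defensive.
Import Order.TTheory GRing.Theory Num.Theory.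
Import numFieldNormedType.Exports.

Local Open Scope classical_set_scope.
Local Open Scope ring_scope.
Local Open Scope complex_scope.

(* Banach algebras need not be unital, so they cannot be built on the ring
   structures of ssralg, which all have a one. *)
HB.mixin Record isBanachAlgebra (K : numFieldType) A
    of CompleteNormedModule K A := {
  bmul : A -> A -> A;
  bmulA : associative bmul;
  bmulPl : forall (k : K) (a b c : A),
    bmul (k *: a + b) c = k *: bmul a c + bmul b c;
  bmulPr : forall (k : K) (a b c : A),
    bmul c (k *: a + b) = k *: bmul c a + bmul c b;
  bmul_norm : forall a b : A, `|bmul a b| <= `|a| * `|b|
}.

#[short(type="banachAlgType")]
HB.structure Definition BanachAlgebra (K : numFieldType) :=
  {A of isBanachAlgebra K A & CompleteNormedModule K A}.

(* The distinguished point is only there because the measurable types of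
   MathComp-Analysis are pointed; it plays no role. *)
HB.mixin Record isTopologicalGroup G of Group G & PointedTopological G := {
  mulg_continuous : continuous (fun xy : G * G => (xy.1 * xy.2)%g);
  invg_continuous : continuous (fun x : G => (x^-1)%g)
}.

#[short(type="topGroupType")]
HB.structure Definition TopologicalGroup :=
  {G of isTopologicalGroup G & Group G & PointedTopological G}.

Section BoundedOperators.
Context {R : realType}.

(* The norm of a normed module over R[i] takes its values in R[i]. *)
Definition rnorm {E : normedModType R[i]} (v : E) : R := complex.Re `|v|.

Definition bounded_linear {E F : normedModType R[i]} (f : E -> F) : Prop :=
  linear f /\ exists M : R, forall v, rnorm (f v) <= M * rnorm v.

(* Only meaningful when f is bounded and linear. *)
Definition opnorm {E F : normedModType R[i]} (f : E -> F) : R :=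
  sup [set rnorm (f v) | v in [set v | rnorm v <= 1]].

Record lin_isometry (E : normedModType R[i]) := LinIsometry {
  iso_fun :> E -> E;
  iso_inv : E -> E;
  isoK : cancel iso_fun iso_inv;
  isoVK : cancel iso_inv iso_fun;
  iso_linear : linear iso_fun;
  iso_norm : forall v, `|iso_fun v| = `|v|
}.

Lemma bounded_linear_id (E : normedModType R[i]) :
  bounded_linear (fun v : E => v).
Proof. by split=> //; exists 1 => v; rewrite mul1r. Qed.

Lemma rnorm_ge0 (E : normedModType R[i]) (v : E) : 0 <= rnorm v.
Proof. by have := normr_ge0 v; rewrite lecE => /andP[]. Qed.

Lemma rnormE (E : normedModType R[i]) (v : E) : `|v| = (rnorm v)%:C.
Proof. by have := normr_ge0 v; rewrite /rnorm; case: `|v| => a b /andP[/eqP/= ->]. Qed.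

Lemma bounded_linear_comp (E F H : normedModType R[i])
    (f : F -> H) (g : E -> F) :
  bounded_linear f -> bounded_linear g -> bounded_linear (fun v => f (g v)).
Proof.
move=> [lf [M fM]] [lg [N gN]]; split=> [k u v|]; first by rewrite lg lf.
exists (`|M| * N) => v; apply: le_trans (fM _) _.
rewrite -mulrA; apply: le_trans (ler_wpM2r (rnorm_ge0 _) (ler_norm M)) _.
exact: ler_wpM2l.
Qed.

Lemma bounded_linear_add (E F : normedModType R[i]) (f g : E -> F) :
  bounded_linear f -> bounded_linear g -> bounded_linear (fun v => f v + g v).
Proof.
move=> [lf [M fM]] [lg [N gN]]; split=> [k u v|].
  by rewrite lf lg scalerDr addrACA.
exists (M + N) => v; rewrite mulrDl.
apply: le_trans (lerD (fM v) (gN v)).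
by rewrite -lecR rmorphD /= -!rnormE; exact: ler_normD.
Qed.

Lemma bounded_linear_scale (E F : normedModType R[i]) (c : R[i]) (f : E -> F) :
  bounded_linear f -> bounded_linear (fun v => c *: f v).
Proof.
move=> [lf [M fM]]; split=> [k u v|].
  by rewrite lf scalerDr !scalerA [c * k]mulrC.
exists (complex.Re `|c| * M) => v.
have -> : rnorm (c *: f v) = complex.Re `|c| * rnorm (f v).
  apply: complexI; rewrite rmorphM /= -!rnormE normrZ.
  by rewrite -[X in X * _ = _]RRe_real ?normr_real.
rewrite -mulrA; apply: ler_wpM2l (fM v).
by have := normr_ge0 c; rewrite lecE => /andP[].
Qed.

Lemma lin_isometry_inv_linear (E : normedModType R[i]) (u : lin_isometry E) :
  linear (iso_inv u).
Proof.
by move=> k v w; rewrite -{1}[v](isoVK u) -{1}[w](isoVK u) -(iso_linear u) isoK.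
Qed.

Lemma bounded_linear_iso (E : normedModType R[i]) (u : lin_isometry E) :
  bounded_linear u.
Proof.
split; first exact: iso_linear.
by exists 1 => v; rewrite /rnorm iso_norm mul1r.
Qed.

Lemma bounded_linear_iso_inv (E : normedModType R[i]) (u : lin_isometry E) :
  bounded_linear (iso_inv u).
Proof.
split; first exact: lin_isometry_inv_linear.
by exists 1 => v; rewrite /rnorm -(iso_norm u) isoVK mul1r.
Qed.

End BoundedOperators.

Section Multipliers.
Context {R : realType} {A : banachAlgType R[i]}.
Implicit Types a b c : A.

(* Double centralizers: lmul m a is m a and rmul m a is a m. *)
Record multiplier := Multiplier {
  lmul : A -> A;
  rmul : A -> A;
  lmul_bounded_linear : bounded_linear lmul;
  rmul_bounded_linear : bounded_linear rmul;
  lmul_bmul : forall a b, lmul (bmul a b) = bmul (lmul a) b;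
  rmul_bmul : forall a b, rmul (bmul a b) = bmul a (rmul b);
  mul_balanced : forall a b, bmul a (lmul b) = bmul (rmul a) b
}.

Implicit Types m n : multiplier.

Definition mult_norm m : R := Order.max (opnorm (lmul m)) (opnorm (rmul m)).

Definition mult_one : multiplier.
Proof.
by refine (@Multiplier (fun a => a) (fun a => a)
  (bounded_linear_id A) (bounded_linear_id A) _ _ _).
Defined.

Definition mult_mul m n : multiplier.
Proof.
refine (@Multiplier (fun a => lmul m (lmul n a)) (fun a => rmul n (rmul m a))
  (bounded_linear_comp (lmul_bounded_linear m) (lmul_bounded_linear n))
  (bounded_linear_comp (rmul_bounded_linear n) (rmul_bounded_linear m)) _ _ _).
- by move=> a b; rewrite !lmul_bmul.
- by move=> a b; rewrite !rmul_bmul.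
- by move=> a b; rewrite !mul_balanced.
Defined.

Lemma bmulDl a b c : bmul (a + b) c = bmul a c + bmul b c.
Proof. by have := bmulPl 1 a b c; rewrite !scale1r. Qed.

Lemma bmulDr a b c : bmul c (a + b) = bmul c a + bmul c b.
Proof. by have := bmulPr 1 a b c; rewrite !scale1r. Qed.

Lemma bmul0l c : bmul 0 c = 0 :> A.
Proof. by apply: (addrI (bmul 0 c)); rewrite -bmulDl !addr0. Qed.

Lemma bmul0r c : bmul c 0 = 0 :> A.
Proof. by apply: (addrI (bmul c 0)); rewrite -bmulDr !addr0. Qed.

Lemma bmulZl (k : R[i]) a c : bmul (k *: a) c = k *: bmul a c.
Proof. by have := bmulPl k a 0 c; rewrite bmul0l !addr0. Qed.

Lemma bmulZr (k : R[i]) a c : bmul c (k *: a) = k *: bmul c a.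
Proof. by have := bmulPr k a 0 c; rewrite bmul0r !addr0. Qed.

Definition mult_add m n : multiplier.
Proof.
refine (@Multiplier (fun a => lmul m a + lmul n a) (fun a => rmul m a + rmul n a)
  (bounded_linear_add (lmul_bounded_linear m) (lmul_bounded_linear n))
  (bounded_linear_add (rmul_bounded_linear m) (rmul_bounded_linear n)) _ _ _).
- by move=> a b; rewrite !lmul_bmul bmulDl.
- by move=> a b; rewrite !rmul_bmul bmulDr.
- by move=> a b; rewrite bmulDl bmulDr !mul_balanced.
Defined.

Definition mult_scale (k : R[i]) m : multiplier.
Proof.
refine (@Multiplier (fun a => k *: lmul m a) (fun a => k *: rmul m a)
  (bounded_linear_scale k (lmul_bounded_linear m))
  (bounded_linear_scale k (rmul_bounded_linear m)) _ _ _).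
- by move=> a b; rewrite lmul_bmul bmulZl.
- by move=> a b; rewrite rmul_bmul bmulZr.
- by move=> a b; rewrite bmulZl bmulZr mul_balanced.
Defined.

Lemma bounded_linear_bmull a : bounded_linear (fun b => bmul a b).
Proof.
split=> [k u v|]; first exact: bmulPr.
exists (rnorm a) => b; rewrite -lecR rmorphM /= -!rnormE; exact: bmul_norm.
Qed.

Lemma bounded_linear_bmulr a : bounded_linear (fun b => bmul b a).
Proof.
split=> [k u v|]; first exact: bmulPl.
exists (rnorm a) => b; rewrite -lecR mulrC rmorphM /= -!rnormE; exact: bmul_norm.
Qed.

Definition mult_of (a : A) : multiplier.
Proof.
refine (@Multiplier (fun b => bmul a b) (fun b => bmul b a)
  (bounded_linear_bmull a) (bounded_linear_bmulr a) _ _ _).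
- by move=> b c; rewrite bmulA.
- by move=> b c; rewrite bmulA.
- by move=> b c; rewrite bmulA.
Defined.

(* Inv_1(M(A)) *)
Record inv1 := Inv1 {
  inv1_val :> multiplier;
  inv1_inv : multiplier;
  inv1_mulV : mult_mul inv1_val inv1_inv = mult_one;
  inv1_Vmul : mult_mul inv1_inv inv1_val = mult_one;
  inv1_norm : mult_norm inv1_val = 1;
  inv1_inv_norm : mult_norm inv1_inv = 1
}.

Definition Ad (u : inv1) (a : A) : A := rmul (inv1_inv u) (lmul u a).

Record isom_aut := IsomAut {
  aut_iso :> lin_isometry A;
  aut_bmul : forall a b, aut_iso (bmul a b) = bmul (aut_iso a) (aut_iso b)
}.

Lemma isom_aut_inv_bmul (f : isom_aut) a b :
  iso_inv f (bmul a b) = bmul (iso_inv f a) (iso_inv f b).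
Proof. by rewrite -{1}(isoVK f a) -{1}(isoVK f b) -aut_bmul isoK. Qed.

(* The canonical extension of an automorphism of A to M(A): the unique one with
   f(m) f(a) = f(m a) and f(a) f(m) = f(a m). *)
Definition aut_mult (f : isom_aut) m : multiplier.
Proof.
refine (@Multiplier (fun a => f (lmul m (iso_inv f a)))
  (fun a => f (rmul m (iso_inv f a)))
  (bounded_linear_comp (bounded_linear_iso f)
    (bounded_linear_comp (lmul_bounded_linear m) (bounded_linear_iso_inv f)))
  (bounded_linear_comp (bounded_linear_iso f)
    (bounded_linear_comp (rmul_bounded_linear m) (bounded_linear_iso_inv f)))
  _ _ _).
- by move=> a b; rewrite isom_aut_inv_bmul lmul_bmul aut_bmul isoVK.
- by move=> a b; rewrite isom_aut_inv_bmul rmul_bmul aut_bmul isoVK.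
- move=> a b; rewrite -{1}(isoVK f a) -{2}(isoVK f b) -!aut_bmul.
  by rewrite mul_balanced.
Defined.

End Multipliers.

Arguments multiplier {R} A.
Arguments inv1 {R} A.
Arguments isom_aut {R} A.

Section ApproximateIdentity.
Context {R : realType} (A : banachAlgType R[i]).

Definition directed_preorder (I : Type) (le : I -> I -> Prop) : Prop :=
  [/\ inhabited I, (forall i, le i i),
      (forall i j k, le i j -> le j k -> le i k) &
      (forall i j, exists k, le i k /\ le j k)].

Definition net_cvg (I : Type) (le : I -> I -> Prop) (e : I -> A) (a : A) :=
  forall eps : R, 0 < eps ->
    exists i0, forall i, le i0 i -> rnorm (e i - a) < eps.

Definition has_cai : Prop :=
  exists (I : Type) (le : I -> I -> Prop) (e : I -> A),
    [/\ directed_preorder le, (forall i, rnorm (e i) <= 1),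
        (forall a, net_cvg le (fun i => bmul (e i) a) a) &
        (forall a, net_cvg le (fun i => bmul a (e i)) a)].

End ApproximateIdentity.

Section Representations.
Context {R : realType} (A : banachAlgType R[i]) (E : normedModType R[i]).

Record representation := Representation {
  rep_fun :> A -> E -> E;
  rep_bounded_linear : forall a, bounded_linear (rep_fun a);
  rep_linear : forall (k : R[i]) a b v,
    rep_fun (k *: a + b) v = k *: rep_fun a v + rep_fun b v;
  rep_mul : forall a b v, rep_fun (bmul a b) v = rep_fun a (rep_fun b v);
  rep_bounded : exists M : R, forall a, opnorm (rep_fun a) <= M * rnorm a
}.

Definition contractive (pi : representation) : Prop :=
  forall a, opnorm (pi a) <= rnorm a.

Definition isometric (pi : representation) : Prop :=
  forall a, opnorm (pi a) = rnorm a.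

Definition nondegenerate (pi : representation) : Prop :=
  closure [set v : E | exists (n : nat) (a : 'I_n -> A) (w : 'I_n -> E),
             v = \sum_(i < n) pi (a i) (w i)] = setT.

(* The unital representations of M(A) on E which extend pi.  If pi is
   nondegenerate, A has a cai and E is complete, there is exactly one. *)
Record extension (pi : representation) := Extension {
  ext_fun :> multiplier A -> E -> E;
  ext_bounded_linear : forall m, bounded_linear (ext_fun m);
  ext_add : forall m n v, ext_fun (mult_add m n) v = ext_fun m v + ext_fun n v;
  ext_scale : forall (k : R[i]) m v,
    ext_fun (mult_scale k m) v = k *: ext_fun m v;
  ext_mul : forall m n v, ext_fun (mult_mul m n) v = ext_fun m (ext_fun n v);
  ext_one : forall v, ext_fun mult_one v = v;
  ext_bounded : exists M : R, forall m, opnorm (ext_fun m) <= M * mult_norm m;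
  ext_of : forall a v, ext_fun (mult_of a) v = pi a v
}.

End Representations.

(* The library has L^p spaces of real-valued functions only.  The complex space
   L^p(mu) is determined up to linear isometry by the following: it is the image
   of the p-integrable functions under a linear map [cls] for which the norm of
   [cls f] is the L^p norm of f. *)
Section ComplexLp.
Context {R : realType} (p : R).

Definition Lp_norm d (T : measurableType d) (mu : {measure set T -> \bar R})
    (f : T -> R[i]) : \bar R :=
  Lnorm mu p%:E (fun x => (complex.Re `|f x|)%:E).

Definition Lp_fun d (T : measurableType d) (mu : {measure set T -> \bar R}) :
    set (T -> R[i]) :=
  [set f | [/\ measurable_fun setT (fun x => complex.Re (f x)),
               measurable_fun setT (fun x => complex.Im (f x)) &
               (Lp_norm mu f < +oo)%E]].

Definition is_Lp d (T : measurableType d) (mu : {measure set T -> \bar R})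
    (E : normedModType R[i]) : Prop :=
  exists cls : (T -> R[i]) -> E,
    [/\ (forall (k : R[i]) f g, Lp_fun mu f -> Lp_fun mu g ->
           cls (fun x => k * f x + g x) = k *: cls f + cls g),
        (forall f, Lp_fun mu f -> (rnorm (cls f))%:E = Lp_norm mu f) &
        (forall v, exists2 f, Lp_fun mu f & cls f = v)].

Definition Lp_space (E : normedModType R[i]) : Prop :=
  exists (d : measure_display) (T : measurableType d)
         (mu : {measure set T -> \bar R}), is_Lp mu E.

Definition sigma_finite_Lp_space (E : normedModType R[i]) : Prop :=
  exists (d : measure_display) (T : measurableType d)
         (mu : {measure set T -> \bar R}), sigma_finite setT mu /\ is_Lp mu E.

Definition nondegenerate_Lp_operator_algebra (A : banachAlgType R[i]) : Prop :=
  exists (E : normedModType R[i]) (pi : representation A E),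
    [/\ Lp_space E, isometric pi & nondegenerate pi].

End ComplexLp.

Section Bochner.
Context {R : realType} d (T : measurableType d)
  (mu : {measure set T -> \bar R}) (E : normedModType R[i]).
Implicit Types f s : T -> E.

Definition simple_function s : Prop :=
  finite_set (range s) /\ forall v, measurable (s @^-1` [set v]).

(* [fine] sends +oo to 0; for an integrable s this only concerns v = 0. *)
Definition simple_integral s : E :=
  \sum_(v \in range s) (fine (mu (s @^-1` [set v])))%:C *: v.

Definition strongly_measurable f : Prop :=
  exists s : nat -> T -> E, (forall n, simple_function (s n)) /\
    forall x, s n x @[n --> \oo] --> f x.

Definition L1_norm f : \bar R := (\int[mu]_x (rnorm (f x))%:E)%E.

Definition bochner_integrable : set (T -> E) :=
  [set f | strongly_measurable f /\ (L1_norm f < +oo)%E].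

Definition is_bochner_integral f (v : E) : Prop :=
  exists s : nat -> T -> E,
    [/\ (forall n, simple_function (s n) /\ (L1_norm (s n) < +oo)%E),
        L1_norm (fun x => f x - s n x) @[n --> \oo] --> 0%E &
        simple_integral (s n) @[n --> \oo] --> v].

(* 0 when f is not integrable. *)
Definition bochner_integral f : E :=
  xget 0 [set v | bochner_integrable f /\ is_bochner_integral f v].

End Bochner.

Section TwistedActions.
Context {R : realType} (G : topGroupType) (A : banachAlgType R[i]).

Record twisted_action := TwistedAction {
  ta_alpha : G -> isom_aut A;
  ta_sigma : G -> G -> inv1 A;
  ta_alpha_continuous : forall a, continuous (fun x => ta_alpha x a);
  ta_sigma_lmul_continuous : forall a,
    continuous (fun xy : G * G => lmul (ta_sigma xy.1 xy.2) a);
  ta_sigma_rmul_continuous : forall a,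
    continuous (fun xy : G * G => rmul (ta_sigma xy.1 xy.2) a);
  ta_alpha1 : forall a, ta_alpha 1%g a = a;
  ta_sigma1x : forall x, ta_sigma 1%g x = mult_one :> multiplier A;
  ta_sigmax1 : forall x, ta_sigma x 1%g = mult_one :> multiplier A;
  ta_alphaM : forall x y a,
    ta_alpha x (ta_alpha y a) = Ad (ta_sigma x y) (ta_alpha (x * y)%g a);
  ta_cocycle : forall x y z,
    mult_mul (aut_mult (ta_alpha z) (ta_sigma x y)) (ta_sigma z (x * y)%g) =
    mult_mul (ta_sigma z x) (ta_sigma (z * x)%g y)
}.

Definition exterior_equivalent (s t : twisted_action) : Prop :=
  exists theta : G -> inv1 A,
    [/\ (forall a, continuous (fun x => lmul (theta x) a)),
        (forall a, continuous (fun x => rmul (theta x) a)),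
        (forall x a, ta_alpha t x a = Ad (theta x) (ta_alpha s x a)) &
        (forall x y,
           mult_mul (ta_sigma t x y) (theta (x * y)%g) =
           mult_mul (mult_mul (theta x) (aut_mult (ta_alpha s x) (theta y)))
                    (ta_sigma s x y))].

(* The extension of [cov_pi] to M(A) being unique, [cov_hat] is not additional
   data. *)
Record covariant_rep (s : twisted_action) (E : normedModType R[i]) :=
    CovariantRep {
  cov_pi : representation A E;
  cov_hat : extension cov_pi;
  cov_u : G -> lin_isometry E;
  cov_nondegenerate : nondegenerate cov_pi;
  cov_u_continuous : forall v, continuous (fun x => cov_u x v);
  cov_uM : forall x y v,
    cov_u x (cov_u y v) = cov_hat (ta_sigma s x y) (cov_u (x * y)%g v);
  cov_piu : forall x a v,
    cov_pi (ta_alpha s x a) v = cov_u x (cov_pi a (iso_inv (cov_u x) v))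
}.

End TwistedActions.

Notation borel G := (g_sigma_algebraType (@open G)).

(* On a second countable locally compact Hausdorff group, Borel measures finite
   on compact sets are automatically regular. *)
Definition left_haar (R : realType) (G : topGroupType)
    (mu : {measure set (borel G) -> \bar R}) : Prop :=
  [/\ (forall (x : G) (B : set (borel G)), measurable B ->
         mu [set (x * y)%g | y in B] = mu B),
      (forall K : set G, compact K -> (mu K < +oo)%E) &
      mu setT <> 0%E].

Section CrossedProduct.
Context {R : realType} (p : R) (G : topGroupType) (A : banachAlgType R[i])
  (mu : {measure set (borel G) -> \bar R}) (s : twisted_action G A).

Definition L1 : set (G -> A) :=
  [set f | bochner_integrable mu (f : borel G -> A)].

Definition twisted_conv (f g : G -> A) (x : G) : A :=
  bochner_integral mu (fun y : borel G =>
    rmul (ta_sigma s y (y^-1 * x)%g)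
         (bmul (f y) (ta_alpha s y (g (y^-1 * x)%g)))).

Definition integrated_form (E : normedModType R[i]) (c : covariant_rep s E)
    (f : G -> A) (v : E) : E :=
  bochner_integral mu (fun x : borel G => cov_pi c (f x) (cov_u c x v)).

Definition Fp_seminorm (f : G -> A) : R :=
  sup [set r | exists (E : normedModType R[i]) (c : covariant_rep s E),
    [/\ sigma_finite_Lp_space p E, contractive (cov_pi c) &
        r = opnorm (integrated_form c f)]].

(* B, together with iota, is the Hausdorff completion of the algebra
   L^1(G, A, alpha, sigma) in the seminorm Fp_seminorm.  Elements of L^1 are
   given by representatives; iota identifies those which are equal almost
   everywhere, since their difference has seminorm 0.  The first half of [fcp_mul]
   does not restrict B: it is part of L^1 being an algebra for the twisted
   convolution, and holds for all twisted actions. *)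
Record is_full_crossed_product (B : banachAlgType R[i])
    (iota : (G -> A) -> B) : Prop := IsFullCrossedProduct {
  fcp_linear : forall (k : R[i]) f g,
    L1 f -> L1 g -> iota (fun x => k *: f x + g x) = k *: iota f + iota g;
  fcp_mul : forall f g,
    L1 f -> L1 g ->
    L1 (twisted_conv f g) /\ iota (twisted_conv f g) = bmul (iota f) (iota g);
  fcp_norm : forall f, L1 f -> rnorm (iota f) = Fp_seminorm f;
  fcp_dense : closure [set iota f | f in L1] = setT
}.

End CrossedProduct.

Definition isometrically_isomorphic (R : realType)
    (B1 B2 : banachAlgType R[i]) : Prop :=
  exists Phi : B1 -> B2,
    [/\ linear Phi, (forall a b, Phi (bmul a b) = bmul (Phi a) (Phi b)),
        (forall b, `|Phi b| = `|b|) & bijective Phi].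

(* Main.v *)
(* Let theta implement the exterior equivalence and put
   (T f)(x) = f(x) theta_x^{-1}.  Then T is an isometric bijection of L^1(G; A)
   which is multiplicative for the two twisted convolutions.  A contractive
   covariant representation (pi, u) of (alpha, sigma) gives the covariant
   representation (pi, x |-> pi^(theta_x) u_x) of (beta, omega) on the same
   space; here pi^(theta_x) is an isometry because pi is contractive and
   nondegenerate and A has a cai.  The integrands pi(f(x)) u_x and
   pi((T f)(x)) pi^(theta_x) u_x are equal, and theta^{-1} implements the
   converse equivalence, so T preserves the two seminorms and extends to the
   completions. *)
Require Import Defs.
From HB Require Import structures.
From mathcomp Require Import all_boot all_order all_algebra.
From mathcomp Require Import complex.
From mathcomp Require Import all_classical all_reals all_analysis.
From mathcomp Require Import measurable_realfun lra.
Import Order.TTheory GRing.Theory Num.Theory.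
Import numFieldNormedType.Exports.
Local Open Scope classical_set_scope.
Local Open Scope ring_scope.
Local Open Scope complex_scope.

Set Implicit Arguments.
Unset Strict Implicit.
Unset Printing Implicit Defensive.

(** * Norms and bounded operators *)

(** Two features shape the proof. The cocycle [theta] is only strictly continuous, so x |-> f(x)
    theta_x^{-1} is not at once a limit of simple functions: twisting a simple function destroys its
    finite range. Second countability gives a countable set whose closure contains the new range,
    and nearest points in it give simple approximants. In the same way the strong continuity of x
    |-> pi^(theta_x) u_x is tested on vectors pi(a)w, where w is close to pi(a)w with a in the unit
    ball of A; such a come from the approximate identity.

    Functions are not identified almost everywhere, and the integral is a choice with default 0. The
    identities between integrands are therefore proved at every point, and an invertible isometry is
    moved through the integral whether or not the integrand is integrable.

    The completions are known only by their properties. They are compared as completions of one and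
    the same L^1, mapped to the first by [iota1] and to the second by [iota2] after T; the
    isomorphism is the closure of the relation between the two images. *)

Section Norms.
Context {R : realType}.
Implicit Types E F : normedModType R[i].

Lemma rnorm0 E : rnorm (0 : E) = 0.
Proof. by rewrite /rnorm normr0. Qed.

Lemma rnorm_eq0 E (v : E) : rnorm v <= 0 -> v = 0.
Proof.
move=> v0; apply/normr0_eq0; rewrite rnormE.
by have -> : rnorm v = 0 by apply/eqP; rewrite eq_le v0 rnorm_ge0.
Qed.

Lemma rnormN E (v : E) : rnorm (- v) = rnorm v.
Proof. by rewrite /rnorm normrN. Qed.

Lemma rdistC E (v w : E) : rnorm (v - w) = rnorm (w - v).
Proof. by rewrite /rnorm distrC. Qed.

Lemma rnormD E (v w : E) : rnorm (v + w) <= rnorm v + rnorm w.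
Proof. by rewrite -lecR rmorphD /= -!rnormE ler_normD. Qed.

Lemma rnormZr E (a : R) (v : E) : rnorm (a%:C *: v) = `|a| * rnorm v.
Proof.
apply: complexI; rewrite rmorphM /= -!rnormE normrZ; congr (_ * _).
by rewrite normc_def /= expr0n addr0 sqrtr_sqr.
Qed.

Lemma rnormZ E (k : R[i]) (v : E) : rnorm (k *: v) = complex.Re `|k| * rnorm v.
Proof.
apply: complexI; rewrite rmorphM /= -!rnormE normrZ.
by rewrite -[X in X * _ = _]RRe_real ?normr_real.
Qed.

Lemma rdist_triangle E (v w z : E) :
  rnorm (v - z) <= rnorm (v - w) + rnorm (w - z).
Proof. by rewrite -(subrKA w v) rnormD. Qed.

Lemma rdist_dist E (v w z : E) :
  `|rnorm (v - z) - rnorm (w - z)| <= rnorm (v - w).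
Proof.
have := rdist_triangle v w z; have := rdist_triangle w v z.
by rewrite (rdistC w v) ler_norml => *; apply/andP; split; lra.
Qed.

Lemma rdist_lt_eq E (v w : E) :
  (forall e : R, 0 < e -> rnorm (v - w) < e) -> v = w.
Proof.
move=> vw; apply/eqP; rewrite -subr_eq0; apply/eqP/rnorm_eq0.
by rewrite leNgt; apply/negP => /vw; rewrite ltxx.
Qed.

(** A positive element of [R[i]] has imaginary part 0, so the radii of the complex-valued norm are
    exactly the positive reals. *)
Lemma rdist_cvgP E (T : Type) (F : set_system T) {FF : Filter F}
    (f : T -> E) (l : E) :
  f @ F --> l <-> forall e : R, 0 < e -> \forall t \near F, rnorm (f t - l) < e.
Proof.
split=> [/cvgrPdist_lt fl e e0|fl].
  have /fl : 0 < e%:C by rewrite ltcR.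
  by apply: filterS => t; rewrite rnormE ltcR rdistC.
apply/cvgrPdist_lt => -[e e']; rewrite ltcE /= => /andP[/eqP -> /fl].
by apply: filterS => t; rewrite rnormE (ltcR _ e) rdistC.
Qed.

Lemma closure_rdistP E (S : set E) v :
  closure S v <-> forall e : R, 0 < e -> exists2 w, S w & rnorm (v - w) < e.
Proof.
split=> [Sv e e0|Sv B /nbhs_ballP[[e e'] /=]].
  have e0' : 0 < e%:C by rewrite ltcR.
  have [w [Sw]] := Sv _ (nbhsx_ballx v _ e0').
  by rewrite -ball_normE /= rnormE ltcR; exists w.
rewrite ltcE /= => /andP[/eqP -> /Sv[w Sw vw]] vB.
by exists w; split=> //; apply: vB; rewrite -ball_normE /= rnormE (ltcR _ e).
Qed.

Lemma bounded_linear_opnorm E F (f : E -> F) (v : E) :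
  bounded_linear f -> rnorm (f v) <= opnorm f * rnorm v.
Proof.
move=> [lf [M fM]].
have f0 : f 0 = 0.
  by have := lf (-1) 0 0; rewrite !scaleN1r oppr0 addNr addr0.
have [->|v0] := eqVneq v 0; first by rewrite f0 !rnorm0 mulr0.
have nv : 0 < rnorm v.
  by rewrite lt_neqAle rnorm_ge0 andbT eq_sym; apply: contra v0 => /eqP h;
    apply/eqP/rnorm_eq0; rewrite h.
rewrite -ler_pdivrMr// mulrC -[leLHS](@ger0_norm _ _)//; last first.
  by rewrite mulr_ge0 ?invr_ge0 ?rnorm_ge0.
rewrite normrM [X in _ * X]ger0_norm ?rnorm_ge0// -rnormZr.
rewrite -[X in rnorm X]addr0 -f0 -lf addr0; apply: ub_le_sup; last first.
  exists ((rnorm v)^-1%:C *: v) => //=.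
  by rewrite rnormZr ger0_norm ?invr_ge0 ?rnorm_ge0// mulVf ?gt_eqF.
exists `|M| => _ [w /= w1 <-]; apply: le_trans (fM w) _.
rewrite -[leRHS]mulr1; apply: le_trans (ler_wpM2r (rnorm_ge0 _) (ler_norm M)) _.
exact: ler_wpM2l.
Qed.

(** For an arbitrary [f] the values may have no supremum; [sup] is then 0. Otherwise it dominates
    the norm of [f 0]. *)
Lemma opnorm_ge0 E F (f : E -> F) : 0 <= opnorm f.
Proof.
rewrite /opnorm; have [[_ ub]|/sup_out -> //] :=
  pselect (has_sup [set rnorm (f v) | v in [set v | rnorm v <= 1]]).
apply: le_trans (rnorm_ge0 (f 0)) _; apply: (ub_le_sup ub).
by exists 0 => //=; rewrite rnorm0 ler01.
Qed.

Lemma bounded_linearB E F (f : E -> F) v w :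
  bounded_linear f -> f (v - w) = f v - f w.
Proof.
by move=> [lf _]; rewrite -scaleN1r addrC lf scaleN1r addrC.
Qed.

Lemma bounded_linear_continuous E F (f : E -> F) :
  bounded_linear f -> continuous f.
Proof.
move=> bf v; apply/rdist_cvgP => e e0.
have M0 : 0 < opnorm f + 1 by rewrite ltr_wpDl ?opnorm_ge0.
have /rdist_cvgP vv : (fun w : E => w) @ nbhs v --> v by exact: cvg_id.
apply: filterS (vv (e / (opnorm f + 1)) _) => [w|]; last exact: divr_gt0.
rewrite -bounded_linearB// ltr_pdivlMr//; apply: le_lt_trans.
apply: le_trans (bounded_linear_opnorm _ bf) _.
by rewrite mulrC ler_wpM2l ?rnorm_ge0// lerDl.
Qed.

End Norms.

(** * Completions *)

Section Completion.
Context {R : realType} {X : Type} {L : set X} {F1 F2 : banachAlgType R[i]}.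
Variables (j1 : X -> F1) (j2 : X -> F2).

(** The closure of the relation formed by the pairs [(j1 f, j2 f)]. It is symmetric in the two
    algebras, so one construction yields both the isomorphism and its inverse. *)
Definition joint_limit (b : F1) (c : F2) : Prop := forall e : R, 0 < e ->
  exists2 f, L f & rnorm (b - j1 f) < e /\ rnorm (c - j2 f) < e.

Hypothesis j_dist : forall f g,
  L f -> L g -> rnorm (j1 f - j1 g) = rnorm (j2 f - j2 g).

(** Distances agree on the pairs [(j1 f, j2 f)] and pass to limits. Equal first entries thus force
    equal second entries, and conversely. *)
Lemma joint_limit_dist b c b' c' :
  joint_limit b c -> joint_limit b' c' -> rnorm (b - b') = rnorm (c - c').
Proof.
move=> bc bc'; apply/eqP; rewrite -subr_eq0 -normr_le0.
apply/ler_addgt0Pr => e e0; rewrite add0r.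
(* One quarter for each of the errors at [b], [c], [b'] and [c']. *)
have e4 : 0 < e / 4 by rewrite divr_gt0.
have [f Lf [bf cf]] := bc _ e4; have [g Lg [bg cg]] := bc' _ e4.
have := j_dist Lf Lg.
have := rdist_dist b (j1 f) b'; have := rdist_dist b' (j1 g) (j1 f).
have := rdist_dist c (j2 f) c'; have := rdist_dist c' (j2 g) (j2 f).
rewrite (rdistC b') (rdistC c') (rdistC (j1 g)) (rdistC (j2 g)).
rewrite !ler_norml => /andP[? ?] /andP[? ?] /andP[? ?] /andP[? ?] ?.
by apply/andP; split; lra.
Qed.

(** A sequence in the image of [j1] converging to [b] is Cauchy; since distances agree, so is its
    counterpart under [j2], which converges by completeness of [F2]. *)
Lemma joint_limit_total b :
  closure [set j1 f | f in L] = setT -> exists c, joint_limit b c.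
Proof.
move=> dense.
have /choice[f fP] n : exists f, L f /\ rnorm (b - j1 f) < n.+1%:R^-1 :> R.
  have /closure_rdistP/(_ n.+1%:R^-1) : closure [set j1 f | f in L] b.
    by rewrite dense.
  by case=> [|_ [f Lf <-] bf]; [rewrite invr_gt0|exists f].
have small (e : R) : 0 < e -> \forall n \near \oo, rnorm (b - j1 (f n)) < e.
  move=> e0; have := near_infty_natSinv_lt (PosNum e0).
  by apply: filterS => n /= /(lt_trans (fP n).2).
have cvg_f : cvg (j2 (f n) @[n --> \oo]).
  apply/cauchy_cvgP/cauchy_exP => -[e e']; rewrite ltcE /= => /andP[/eqP -> e0].
  have e2 : 0 < e / 2 by rewrite divr_gt0.
  have [N _ Ne] := small _ e2; exists (j2 (f N)), N => // n /= Nn.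
  rewrite -ball_normE /= rnormE (ltcR _ e).
  rewrite -j_dist; [|exact: (fP _).1|exact: (fP _).1].
  apply: le_lt_trans (rdist_triangle _ b _) _; rewrite (rdistC _ b).
  have bn : rnorm (b - j1 (f n)) < e / 2 by exact: Ne.
  have bN : rnorm (b - j1 (f N)) < e / 2 by apply: Ne => /=.
  lra.
exists (limn (j2 \o f)) => e e0.
have := cvg_f => /rdist_cvgP/(_ _ e0)[M _ cM].
have [N _ Ne] := small _ e0; exists (f (maxn M N)); first exact: (fP _).1.
split; first by apply: Ne; exact: leq_maxr.
by rewrite rdistC; apply: cM; exact: leq_maxl.
Qed.

End Completion.

Lemma rnorm_bmul {R : realType} {B : banachAlgType R[i]} (b c : B) :
  rnorm (bmul b c) <= rnorm b * rnorm c.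
Proof. by rewrite -lecR rmorphM /= -!rnormE bmul_norm. Qed.

(** The constant depends on [b] and [b'] only: bb' - fg = (b - f)b' + b(b' - g) - (b - f)(b' - g).
    The condition [d <= 1] makes the quadratic error linear, which costs the summand 1 in [M]. *)
Lemma bmul_near {R : realType} {B : banachAlgType R[i]} (b b' f g : B)
    (M d : R) :
  d <= 1 -> rnorm b + rnorm b' + 1 <= M ->
  rnorm (b - f) < d -> rnorm (b' - g) < d ->
  rnorm (bmul b b' - bmul f g) <= M * d.
Proof.
move=> d1 bM bf bg.
have -> : bmul b b' - bmul f g = bmul (b - f) b' + (bmul b (b' - g) -
    bmul (b - f) (b' - g)).
  rewrite -(bounded_linearB _ _ (bounded_linear_bmulr _)).
  rewrite opprB addrCA subrr addr0.
  rewrite (bounded_linearB _ _ (bounded_linear_bmull _)).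
  rewrite (bounded_linearB _ _ (bounded_linear_bmulr _)).
  by rewrite addrA addrNK.
apply: le_trans (rnormD _ _) _.
have := rnormD (bmul b (b' - g)) (- bmul (b - f) (b' - g)).
rewrite rnormN.
have := rnorm_bmul (b - f) b'; have := rnorm_bmul b (b' - g).
have := rnorm_bmul (b - f) (b' - g).
have := rnorm_ge0 (b - f); have := rnorm_ge0 (b' - g).
have := rnorm_ge0 b; have := rnorm_ge0 b'.
nra.
Qed.

(** Uniqueness of the Hausdorff completion of a seminormed algebra. [X] is a bare type with
    operations, because its points are representatives which [j1] and [j2] may identify. *)
Lemma isometric_completions {R : realType} {X : Type} {L : set X}
    {F1 F2 : banachAlgType R[i]} {j1 : X -> F1} {j2 : X -> F2}
    {add : R[i] -> X -> X -> X} {mul : X -> X -> X} :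
  (forall k f g, L f -> L g -> L (add k f g)) ->
  (forall f g, L f -> L g -> L (mul f g)) ->
  (forall k f g, L f -> L g -> j1 (add k f g) = k *: j1 f + j1 g) ->
  (forall k f g, L f -> L g -> j2 (add k f g) = k *: j2 f + j2 g) ->
  (forall f g, L f -> L g -> j1 (mul f g) = bmul (j1 f) (j1 g)) ->
  (forall f g, L f -> L g -> j2 (mul f g) = bmul (j2 f) (j2 g)) ->
  (forall f, L f -> rnorm (j1 f) = rnorm (j2 f)) ->
  closure [set j1 f | f in L] = setT ->
  closure [set j2 f | f in L] = setT ->
  isometrically_isomorphic F1 F2.
Proof.
move=> L_add L_mul add1 add2 mul1 mul2 j_norm dense1 dense2.
have j_dist f g : L f -> L g -> rnorm (j1 f - j1 g) = rnorm (j2 f - j2 g).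
  move=> Lf Lg; rewrite -rnormN opprB -(rnormN (j2 f - _)) opprB.
  have := j_norm _ (L_add (-1) _ _ Lf Lg).
  by rewrite add1// add2// !scaleN1r ![- _ + _]addrC.
have jlC b c :
    joint_limit (L := L) j1 j2 b c <-> joint_limit (L := L) j2 j1 c b.
  by split=> bc e /bc[f Lf []]; exists f.
have /choice[Phi PhiP] b : exists c, joint_limit (L := L) j1 j2 b c.
  exact: joint_limit_total.
have /choice[Psi PsiP] c : exists b, joint_limit (L := L) j1 j2 b c.
  have j_dist' f g : L f -> L g -> rnorm (j2 f - j2 g) = rnorm (j1 f - j1 g).
    by move=> Lf Lg; rewrite j_dist.
  have [b] := joint_limit_total j_dist' c dense2.
  by rewrite -jlC; exists b.
have Phi_uniq b c : joint_limit (L := L) j1 j2 b c -> Phi b = c.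
  move=> bc; apply/rdist_lt_eq => e e0.
  by rewrite -(joint_limit_dist j_dist (PhiP b) bc) subrr rnorm0.
have jl_add k b c b' c' : joint_limit (L := L) j1 j2 b c ->
    joint_limit (L := L) j1 j2 b' c' ->
    joint_limit (L := L) j1 j2 (k *: b + b') (k *: c + c').
  move=> bc bc' e e0; have K0 := rnorm_ge0 (k *: b).
  have k0 : 0 <= complex.Re `|k|.
    by have := normr_ge0 k; rewrite lecE => /andP[].
  pose d := e / (complex.Re `|k| + 1).
  have kd : complex.Re `|k| * d + d = e.
    by rewrite -[X in _ + X]mul1r -mulrDl /d mulrC divfK// gt_eqF// ltr_wpDl.
  have d0 : 0 < d by rewrite divr_gt0// ltr_wpDl.
  have near (F : banachAlgType R[i]) (v v' w w' : F) : rnorm (v - w) < d ->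
      rnorm (v' - w') < d -> rnorm (k *: v + v' - (k *: w + w')) < e.
    move=> vw vw'; rewrite opprD addrACA -scalerBr -kd.
    apply: le_lt_trans (rnormD _ _) _.
    by rewrite rnormZ ler_ltD// ler_wpM2l// ltW.
  have [f Lf [bf cf]] := bc _ d0; have [g Lg [bg cg]] := bc' _ d0.
  exists (add k f g); first exact: L_add.
  by rewrite add1// add2//; split; apply: near.
have jl_mul b c b' c' : joint_limit (L := L) j1 j2 b c ->
    joint_limit (L := L) j1 j2 b' c' ->
    joint_limit (L := L) j1 j2 (bmul b b') (bmul c c').
  move=> bc bc' e e0.
  (* One [M] and one [d] have to serve both algebras; dividing by [M + 1] makes [M * d < e]
     strict. *)
  pose M := Num.max (rnorm b + rnorm b' + 1) (rnorm c + rnorm c' + 1).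
  have M0 : 0 < M + 1.
    by rewrite ltr_wpDl// le_max ?addr_ge0 ?rnorm_ge0.
  pose d := Num.min 1 (e / (M + 1)).
  have d0 : 0 < d by rewrite lt_min ltr01 divr_gt0.
  have Md : M * d < e.
    have : (M + 1) * d <= e.
      by rewrite mulrC -ler_pdivlMr// /d ge_min lexx orbT.
    lra.
  have [f Lf [bf cf]] := bc _ d0; have [g Lg [bg cg]] := bc' _ d0.
  exists (mul f g); first exact: L_mul.
  rewrite mul1// mul2//.
  by split; apply: le_lt_trans Md; apply: bmul_near => //;
    rewrite ?ge_min ?lexx// le_max lexx ?orbT.
exists Phi; split.
- by move=> k b b'; apply: Phi_uniq; exact: jl_add.
- by move=> b b'; apply: Phi_uniq; exact: jl_mul.
- move=> b; rewrite !rnormE; congr (_%:C).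
  (* The pair [(0, Phi 0)] minus itself is [(0, 0)]; preservation of norms is then preservation of
     the distance to 0. *)
  have /Phi_uniq Phi0 : joint_limit (L := L) j1 j2 0 0.
    have := jl_add (-1) _ _ _ _ (PhiP 0) (PhiP 0).
    by rewrite !scaleN1r !addNr.
  have := joint_limit_dist j_dist (PhiP b) (PhiP 0).
  by rewrite Phi0 !subr0.
- exists Psi => [b|c]; last exact: Phi_uniq.
  apply/rdist_lt_eq => e e0.
  by rewrite (joint_limit_dist j_dist (PsiP (Phi b)) (PhiP b)) subrr rnorm0.
Qed.

(** * Multipliers and nondegenerate representations *)

Section MultiplierTheory.
Context {R : realType} {A : banachAlgType R[i]}.
Implicit Types (m n : multiplier A) (u : inv1 A) (a b c : A).

Lemma multiplier_eq m n : lmul m =1 lmul n -> rmul m =1 rmul n -> m = n.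
Proof.
case: m n => [l r bl br l_b r_b lr] [l' r' bl' br' l_b' r_b' lr'] /=.
move=> /funext ll' /funext rr'; subst l' r'.
by congr Multiplier; exact: Prop_irrelevance.
Qed.

Lemma rnorm_lmul m a : rnorm (lmul m a) <= mult_norm m * rnorm a.
Proof.
apply: le_trans (bounded_linear_opnorm _ (lmul_bounded_linear m)) _.
by rewrite ler_wpM2r ?rnorm_ge0// le_max lexx.
Qed.

Lemma rnorm_rmul m a : rnorm (rmul m a) <= mult_norm m * rnorm a.
Proof.
apply: le_trans (bounded_linear_opnorm _ (rmul_bounded_linear m)) _.
by rewrite ler_wpM2r ?rnorm_ge0// le_max lexx orbT.
Qed.

(** Together with [mult_of_mul]: A is a two-sided ideal of M(A). This determines an extended
    representation on the vectors pi(a)v. *)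
Lemma mult_mul_of m a : mult_mul m (mult_of a) = mult_of (lmul m a).
Proof. by apply: multiplier_eq => b /=; rewrite ?lmul_bmul ?mul_balanced. Qed.

Lemma mult_of_mul m a : mult_mul (mult_of a) m = mult_of (rmul m a).
Proof. by apply: multiplier_eq => b /=; rewrite ?rmul_bmul ?mul_balanced. Qed.

Lemma mult_norm_ge0 m : 0 <= mult_norm m.
Proof. by rewrite le_max opnorm_ge0. Qed.

Definition inv1V u : inv1 A :=
  Inv1 (inv1_Vmul u) (inv1_mulV u) (inv1_inv_norm u) (inv1_norm u).

Lemma lmulK u : cancel (lmul u) (lmul (inv1_inv u)).
Proof. by move=> a; exact: (congr1 (@lmul _ A ^~ a) (inv1_Vmul u)). Qed.

Lemma lmulVK u : cancel (lmul (inv1_inv u)) (lmul u).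
Proof. exact: lmulK (inv1V u). Qed.

Lemma rmulK u : cancel (rmul u) (rmul (inv1_inv u)).
Proof. by move=> a; exact: (congr1 (@rmul _ A ^~ a) (inv1_mulV u)). Qed.

Lemma rmulVK u : cancel (rmul (inv1_inv u)) (rmul u).
Proof. exact: rmulK (inv1V u). Qed.

(** Multiplication by [u] and by its inverse are contractions inverse to each other. *)
Lemma rnorm_lmul_inv1 u a : rnorm (lmul u a) = rnorm a.
Proof.
apply/eqP; rewrite eq_le -{3}[a](lmulK u); apply/andP; split.
  by have := rnorm_lmul u a; rewrite inv1_norm mul1r.
by have := rnorm_lmul (inv1_inv u) (lmul u a); rewrite inv1_inv_norm mul1r.
Qed.

Lemma rnorm_rmul_inv1 u a : rnorm (rmul u a) = rnorm a.
Proof.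
apply/eqP; rewrite eq_le -{3}[a](rmulK u); apply/andP; split.
  by have := rnorm_rmul u a; rewrite inv1_norm mul1r.
by have := rnorm_rmul (inv1_inv u) (rmul u a); rewrite inv1_inv_norm mul1r.
Qed.

Lemma aut_lmul (f : isom_aut A) m a : f (lmul m a) = lmul (aut_mult f m) (f a).
Proof. by rewrite /= isoK. Qed.

Lemma aut_rmul (f : isom_aut A) m a : f (rmul m a) = rmul (aut_mult f m) (f a).
Proof. by rewrite /= isoK. Qed.

Lemma aut_lmulK (f : isom_aut A) u :
  cancel (lmul (aut_mult f u)) (lmul (aut_mult f (inv1_inv u))).
Proof. by move=> a /=; rewrite isoK lmulK isoVK. Qed.

Lemma aut_rmulVK (f : isom_aut A) u :
  cancel (rmul (aut_mult f (inv1_inv u))) (rmul (aut_mult f u)).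
Proof. by move=> a /=; rewrite isoK rmulVK isoVK. Qed.

Lemma bmul_faithful a b : has_cai A -> (forall c, bmul c a = bmul c b) -> a = b.
Proof.
move=> [I [le [e [[_ le_refl _ le_ub] _ ea _]]]] ab; apply: rdist_lt_eq => d d0.
have d2 : 0 < d / 2 by rewrite divr_gt0.
have [i ia] := ea a _ d2; have [j jb] := ea b _ d2.
have [k [ik jk]] := le_ub i j.
have := ia _ ik; have := jb _ jk; rewrite ab (rdistC _ a).
by have := rdist_triangle a (bmul (e k) b) b; lra.
Qed.

(** The axioms of a double centralizer do not contain m(an) = (ma)n. Multiplied by any c from the
    left, both sides become ((cm)a)n, and the approximate identity lets c be cancelled. This makes u
    a u^{-1} unambiguous in [Ad]. *)
Lemma lmul_rmulC m n a : has_cai A -> lmul m (rmul n a) = rmul n (lmul m a).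
Proof.
move=> cai; apply: bmul_faithful => // c.
by rewrite mul_balanced -!rmul_bmul mul_balanced.
Qed.

End MultiplierTheory.

Section NondegenerateRepresentations.
Context {R : realType} {A : banachAlgType R[i]} {E : normedModType R[i]}.
Variables (pi : representation A E).
Hypotheses (cai : has_cai A) (pi_nondeg : Defs.nondegenerate pi).
Hypothesis pi_contr : contractive pi.

Lemma rnorm_rep a v : rnorm (pi a v) <= rnorm a * rnorm v.
Proof.
apply: le_trans (bounded_linear_opnorm _ (rep_bounded_linear pi a)) _.
by rewrite ler_wpM2r ?rnorm_ge0.
Qed.

Lemma repB a b v : pi (a - b) v = pi a v - pi b v.
Proof. by rewrite -scaleN1r addrC rep_linear scaleN1r addrC. Qed.

(** The approximate identity acts as one on E: on pi(a)w because e_i a tends to a, on finite sums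
    because the index set is directed, and on all of E by density, since the operators pi(e_i) are
    contractions. *)
Lemma cai_approx v (d : R) : 0 < d ->
  exists a, rnorm a <= 1 /\ rnorm (v - pi a v) < d.
Proof.
have [I [le [e [[[i0] le_refl le_tr le_ub] e1 ea _]]]] := cai.
pose good w := forall d : R, 0 < d ->
  exists i, forall j, le i j -> rnorm (w - pi (e j) w) < d.
have good_sum n (a : 'I_n -> A) (w : 'I_n -> E) :
    good (\sum_(i < n) pi (a i) (w i)).
  apply: (big_ind good) => [{}d d0|w1 w2 g1 g2 {}d d0|i _ {}d d0].
  - exists i0 => j _; have := rnorm_rep (e j) 0.
    by rewrite !rnorm0 mulr0 sub0r rnormN => /le_lt_trans; apply.
  - have d2 : 0 < d / 2 by rewrite divr_gt0.
    have [i1 h1] := g1 _ d2; have [i2 h2] := g2 _ d2.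
    have [k [ik1 ik2]] := le_ub i1 i2; exists k => j kj.
    have [lin_e _] := rep_bounded_linear pi (e j).
    have -> : pi (e j) (w1 + w2) = pi (e j) w1 + pi (e j) w2.
      by have := lin_e 1 w1 w2; rewrite !scale1r.
    rewrite opprD addrACA; apply: le_lt_trans (rnormD _ _) _.
    have := h1 _ (le_tr _ _ _ ik1 kj); have := h2 _ (le_tr _ _ _ ik2 kj); lra.
  - have w0 : 0 < rnorm (w i) + 1 by rewrite ltr_wpDl ?rnorm_ge0.
    have [k hk] := ea (a i) _ (divr_gt0 d0 w0); exists k => j /hk.
    rewrite ltr_pdivlMr// -rep_mul -repB rdistC; apply: le_lt_trans.
    by apply: le_trans (rnorm_rep _ _) _; rewrite ler_wpM2l ?rnorm_ge0 ?lerDl.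
move=> d0; have d4 : 0 < d / 4 by rewrite divr_gt0.
have /closure_rdistP/(_ _ d4)[w [n [a [z zE]]] vw] :
    closure [set v : E | exists (n : nat) (a : 'I_n -> A) (w : 'I_n -> E),
      v = \sum_(i < n) pi (a i) (w i)] v.
  by have := pi_nondeg; rewrite /Defs.nondegenerate => ->.
have [i hi] : exists i, forall j, le i j -> rnorm (w - pi (e j) w) < d / 4.
  by rewrite zE; exact: good_sum.
exists (e i); split=> //.
have := rdist_triangle v w (pi (e i) v).
have := rdist_triangle w (pi (e i) w) (pi (e i) v).
have := hi _ (le_refl i); have := rnorm_rep (e i) (w - v).
rewrite (bounded_linearB _ _ (rep_bounded_linear pi _)).
have := e1 i; have := rnorm_ge0 (w - v); have := rnorm_ge0 (e i).
by move: vw; rewrite (rdistC v w); nra.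
Qed.

(** [v] is a limit of vectors pi(a)v with a in the unit ball, and [f] is continuous. The bound [C]
    passes to [v] unchanged because the approximate identity is contractive. *)
Lemma rnorm_le_on_range (F : normedModType R[i]) (f : E -> F) (C : R) v :
  bounded_linear f -> (forall a, rnorm a <= 1 -> rnorm (f (pi a v)) <= C) ->
  rnorm (f v) <= C.
Proof.
move=> bf fC; apply/ler_addgt0Pr => d d0.
have M0 : 0 < opnorm f + 1 by rewrite ltr_wpDl ?opnorm_ge0.
have [a [a1]] := cai_approx v (divr_gt0 d0 M0); rewrite ltr_pdivlMr// => va.
have := bounded_linear_opnorm (v - pi a v) bf; rewrite bounded_linearB//.
have := fC _ a1; have := rnormD (f v - f (pi a v)) (f (pi a v)); rewrite subrK.
have := rnorm_ge0 (v - pi a v).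
nra.
Qed.

Lemma eq_on_range (F : normedModType R[i]) (f g : E -> F) :
  bounded_linear f -> bounded_linear g ->
  (forall a v, f (pi a v) = g (pi a v)) -> f =1 g.
Proof.
move=> bf bg fg v; apply/eqP; rewrite -subr_eq0 -scaleN1r; apply/eqP/rnorm_eq0.
apply: (rnorm_le_on_range (f := fun v => f v + -1 *: g v)) => [|a _].
  exact/bounded_linear_add/bounded_linear_scale.
by rewrite fg scaleN1r subrr rnorm0.
Qed.

Variable hat : extension pi.

Lemma ext_lmul m a v : hat m (pi a v) = pi (lmul m a) v.
Proof. by rewrite -!(ext_of hat) -ext_mul mult_mul_of. Qed.

Lemma ext_rmul m a v : pi a (hat m v) = pi (rmul m a) v.
Proof. by rewrite -!(ext_of hat) -ext_mul mult_of_mul. Qed.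

(** [ext_bounded] only provides some constant. The constant 1 comes from the vectors pi(a)v with a
    in the unit ball, which [hat m] sends to pi(ma)v. *)
Lemma rnorm_ext m v : rnorm (hat m v) <= mult_norm m * rnorm v.
Proof.
apply: rnorm_le_on_range (ext_bounded_linear hat m) _ => a a1.
rewrite ext_lmul; apply: le_trans (rnorm_rep _ _) _.
rewrite ler_wpM2r ?rnorm_ge0//; apply: le_trans (rnorm_lmul _ _) _.
by rewrite ler_piMr ?mult_norm_ge0.
Qed.

End NondegenerateRepresentations.

(** * Simple functions *)

Section FiniteRange.
Context {R : realType} d {T : measurableType d} {I : choiceType}.
Variables (mu : {measure set T -> \bar R}) (q : T -> I).
Hypotheses (q_fin : finite_set (range q))
  (q_meas : forall i, measurable (q @^-1` [set i])).

Lemma finite_range_preimage (B : set I) : measurable (q @^-1` B).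
Proof.
have -> : q @^-1` B = \bigcup_(i in range q `&` B) q @^-1` [set i].
  apply/seteqP; split=> [x Bqx|x [i [_ Bi] /= ->//]].
  by exists (q x) => //; split=> //; exists x.
apply: fin_bigcup_measurable => [|i _]; last exact: q_meas.
exact: finite_setIl.
Qed.

Lemma finite_range_measurable d' (T' : measurableType d') (h : I -> T') :
  measurable_fun setT (h \o q).
Proof.
by move=> _ B _; rewrite setTI comp_preimage; exact: finite_range_preimage.
Qed.

(** The values lie in an arbitrary choice type so that [q] can be a pair of simple functions, whose
    fibres form their common refinement. *)
Lemma finite_range_integral (h : I -> R) : (forall i, 0 <= h i) ->
  (\int[mu]_x (h (q x))%:E =
   \sum_(i \in range q) (h i)%:E * mu (q @^-1` [set i]))%E.
Proof.
move=> h0.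
transitivity (\int[mu]_x (\sum_(i \in range q)
    (h i)%:E * (\1_(q @^-1` [set i]) x)%:E)%E)%E.
  apply: eq_integral => x _.
  rewrite (fsbigD1 (q x))//=; last by exists x.
  rewrite indicE mem_set//= mule1 fsbig1 ?adde0// => i [_ /= iq].
  by rewrite indicE memNset/= ?mule0// => qi; apply: iq; rewrite qi.
rewrite ge0_integral_fsum//; last 2 first.
- by move=> i; apply: measurable_funeM; exact/measurable_EFinP/measurable_indic.
- by move=> i x _; rewrite mule_ge0// lee_fin.
apply: eq_fsbigr => i _; rewrite ge0_integralZl_EFin//; last first.
  exact/measurable_EFinP/measurable_indic.
by rewrite integral_indic// setIT.
Qed.

End FiniteRange.

Section SimpleFunctions.
Context {R : realType} d {T : measurableType d}
  (mu : {measure set T -> \bar R}) {E : normedModType R[i]}.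
Implicit Types s : T -> E.

(** A fibre of infinite measure over [v != 0] would contribute an infinite term to the integral of
    the norm. *)
Lemma simple_measure_fin s v : simple_function s -> (L1_norm mu s < +oo)%E ->
  v != 0 -> (mu (s @^-1` [set v]) < +oo)%E.
Proof.
move=> [s_fin s_meas] s_int v0.
have nv : 0 < rnorm v.
  rewrite lt_neqAle rnorm_ge0 andbT eq_sym; apply: contra v0 => /eqP h.
  by apply/eqP/rnorm_eq0; rewrite h.
have [[x _ sx]|noxv] := pselect (range s v); last first.
  rewrite (_ : _ @^-1` _ = set0) ?measure0//.
  by apply/seteqP; split=> // x /= sxv; apply: noxv; exists x.
move: s_int; rewrite /L1_norm (finite_range_integral _ s_fin s_meas) => [|i];
  last exact: rnorm_ge0.
rewrite (fsbigD1 v)//=; last by exists x.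
move=> s_int; rewrite ltNge leye_eq; apply/negP => /eqP mu_oo.
move: s_int; rewrite mu_oo gt0_muley ?lte_fin// addye ?ltxx//.
rewrite -ltNye; apply: lt_le_trans (ltNyr 0) _.
by apply: fsume_ge0 => i _; rewrite mule_ge0// lee_fin rnorm_ge0.
Qed.

(** The integral may be computed on a finer finite partition. [fine] is additive on finite measures
    only, hence the condition on the fibres over nonzero values; those over 0 contribute 0 on both
    sides. *)
Lemma simple_integral_comp (I : choiceType) (q : T -> I) (phi : I -> E) :
  finite_set (range q) -> (forall i, measurable (q @^-1` [set i])) ->
  (forall v, v != 0 -> (mu ((phi \o q) @^-1` [set v]) < +oo)%E) ->
  simple_integral mu (phi \o q) =
  \sum_(i \in range q) (fine (mu (q @^-1` [set i])))%:C *: phi i.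
Proof.
move=> q_fin q_meas s_fin; set s := phi \o q.
have rs_fin : finite_set (range s).
  by rewrite /s -(image_comp q phi); apply: finite_image.
transitivity (\sum_(v \in range s) \sum_(i \in range q)
    if i \in phi @^-1` [set v] then (fine (mu (q @^-1` [set i])))%:C *: phi i
    else 0).
  apply: eq_fsbigr => v _; rewrite -fsbig_mkcondr.
  have fD : finite_set (range q `&` phi @^-1` [set v]) by exact: finite_setIl.
  have [->|v0] := eqVneq v 0.
    by rewrite scaler0 fsbig1// => i [_ /= ->]; rewrite scaler0.
  have -> : s @^-1` [set v] =
      \bigcup_(i in range q `&` phi @^-1` [set v]) q @^-1` [set i].
    apply/seteqP; split=> [x sxv|x [i [_ /= iv] /= qx]];
      last by rewrite /s /= qx.
    by exists (q x) => //; split=> //; exists x.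
  rewrite measure_fin_bigcup//; last exact/trivIset_preimage1.
  rewrite !fsbig_finite//= big_seq -sum_fine => [|i]; last first.
    rewrite in_fset_set// inE => -[_ /= iv]; rewrite fin_numElt.
    rewrite (lt_le_trans _ (measure_ge0 _ _)) ?ltNyr//=.
    apply: le_lt_trans (s_fin _ v0); apply: le_measure; rewrite ?inE//.
      exact: (finite_range_preimage q_fin q_meas (phi @^-1` [set v])).
    by move=> x /= qx; rewrite /s /= qx.
  rewrite rmorph_sum scaler_suml [RHS]big_seq; apply: eq_bigr => i.
  by rewrite in_fset_set// inE => -[_ /= ->].
rewrite exchange_fsbig//; apply: eq_fsbigr => i /set_mem[x _ <-].
rewrite (fsbigD1 (s x))//=; last by exists x.
rewrite ifT ?inE// fsbig1 ?addr0// => v [_ /= vs].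
by rewrite ifF//; apply/negP; rewrite inE => /= /esym.
Qed.

Lemma simple_function_pair s s' : simple_function s -> simple_function s' ->
  finite_set (range (fun x => (s x, s' x))) /\
  forall i, measurable ((fun x => (s x, s' x)) @^-1` [set i]).
Proof.
move=> ss ss'; split.
  apply: (sub_finite_set (B := range s `*` range s')).
    by move=> _ [x _ <-]; split; exists x.
  by apply: finite_setX; [exact: ss.1|exact: ss'.1].
move=> i; rewrite (_ : _ @^-1` _ = s @^-1` [set i.1] `&` s' @^-1` [set i.2]).
  by apply: measurableI; [exact: ss.2|exact: ss'.2].
by case: i => v w; apply/seteqP; split=> x /= -[<- <-].
Qed.

Lemma simple_function_comp2 (F : normedModType R[i]) (g : E -> E -> F) s s' :
  simple_function s -> simple_function s' ->
  simple_function (fun x => g (s x) (s' x)).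
Proof.
move=> ss ss'; have [q_fin q_meas] := simple_function_pair ss ss'; split.
  rewrite -(image_comp (fun x => (s x, s' x)) (fun i => g i.1 i.2)).
  by apply: finite_image.
by move=> v; exact: (finite_range_preimage q_fin q_meas
  ((fun i => g i.1 i.2) @^-1` [set v])).
Qed.

Lemma simple_function_comp (F : normedModType R[i]) (g : E -> F) s :
  simple_function s -> simple_function (g \o s).
Proof. by move=> ss; exact: (simple_function_comp2 (fun v _ => g v) ss ss). Qed.

(** On the common refinement the difference of the integrals is a single finite sum, to which the
    triangle inequality applies. *)
Lemma simple_integral_dist s s' : simple_function s -> simple_function s' ->
  (L1_norm mu s < +oo)%E -> (L1_norm mu s' < +oo)%E ->
  ((rnorm (simple_integral mu s - simple_integral mu s')%R)%:E <=
   L1_norm mu (fun x => (s x - s' x)%R))%E.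
Proof.
move=> ss ss' is_ is'; pose q x := (s x, s' x).
have [q_fin q_meas] := simple_function_pair ss ss'.
have -> : s = fst \o q by [].
have -> : s' = snd \o q by [].
rewrite !simple_integral_comp//; last 2 first.
- by move=> v; exact: simple_measure_fin.
- by move=> v; exact: simple_measure_fin.
rewrite /L1_norm (finite_range_integral _ q_fin q_meas
  (h := fun i => rnorm (i.1 - i.2))) => [|i]; last exact: rnorm_ge0.
have -> : \sum_(i \in range q) (fine (mu (q @^-1` [set i])))%:C *: i.1 -
    \sum_(i \in range q) (fine (mu (q @^-1` [set i])))%:C *: i.2 =
    \sum_(i \in range q) (fine (mu (q @^-1` [set i])))%:C *: (i.1 - i.2).
  rewrite !fsbig_finite//= -sumrB; apply: eq_bigr => i _.
  by rewrite scalerBr.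
rewrite !fsbig_finite//=.
elim/big_rec2: _ => [|i x y _ xy]; first by rewrite rnorm0.
apply: (@le_trans _ _ (rnorm ((fine (mu (q @^-1` [set i])))%:C *: (i.1 - i.2)) +
  rnorm y)%:E); first by rewrite lee_fin rnormD.
rewrite EFinD leeD// rnormZr ger0_norm ?fine_ge0//.
rewrite EFinM muleC.
have [->|i0] := eqVneq (rnorm (i.1 - i.2)) 0; first by rewrite !mul0e.
rewrite fineK// fin_numElt (lt_le_trans _ (measure_ge0 _ _)) ?ltNyr//=.
(* The two entries differ, so one of them is nonzero, and the integrability of that function makes
   the fibre of finite measure. *)
have [i1|i1] := eqVneq i.1 0; last first.
  apply: le_lt_trans (simple_measure_fin ss is_ i1).
  apply: le_measure; rewrite ?inE//; first exact: ss.2.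
  by move=> t /= <-.
have i2 : i.2 != 0.
  by apply: contra i0 => /eqP i2; rewrite i1 i2 subrr rnorm0.
apply: le_lt_trans (simple_measure_fin ss' is' i2).
apply: le_measure; rewrite ?inE//; first exact: ss'.2.
by move=> t /= <-.
Qed.

End SimpleFunctions.

(** * The Bochner integral *)

Section BochnerIntegral.
Context {R : realType} d {T : measurableType d}
  (mu : {measure set T -> \bar R}) {E : normedModType R[i]}.
Implicit Types (f s : T -> E) (u : lin_isometry E).

Lemma strongly_measurable_dist f s :
  strongly_measurable f -> simple_function s ->
  measurable_fun setT (fun x => rnorm (f x - s x)).
Proof.
move=> [t [simple_t t_f]] simple_s.
apply: (measurable_fun_cvg (h := fun n x => rnorm (t n x - s x))) => [n|x _].
  have [q_fin q_meas] := simple_function_pair (simple_t n) simple_s.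
  exact: (finite_range_measurable q_fin q_meas (fun i => rnorm (i.1 - i.2))).
apply/cvgrPdist_lt => e e0; have /rdist_cvgP/(_ _ e0) := t_f x.
apply: filterS => n; apply: le_lt_trans.
by apply: le_trans (rdist_dist _ _ _) _; rewrite rdistC.
Qed.

(** For large n the integrals of [s n] and [t n] differ by at most the L^1 distance of the two,
    hence by at most the sum of their distances to [f]. Strong measurability of [f] allows these
    norm integrals to be added. *)
Lemma bochner_integral_uniq f v w : strongly_measurable f ->
  is_bochner_integral mu f v -> is_bochner_integral mu f w -> v = w.
Proof.
move=> fm [s [simple_s s_f s_v]] [t [simple_t t_f t_w]].
apply: rdist_lt_eq => e e0.
have e4 : 0 < e / 4 by rewrite divr_gt0.
have close (r : nat -> T -> E) :
    (L1_norm mu (fun x => (f x - r n x)%R) @[n --> \oo] --> 0)%E ->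
    \forall n \near \oo, (L1_norm mu (fun x => f x - r n x)%R < (e / 4)%:E)%E.
  by move=> r0; apply: (r0 [set y | (y < (e / 4)%:E)%E]); exact: lt_nbhsl.
have : \forall n \near \oo, rnorm (v - w) < e; last first.
  by case=> n _ /(_ n (leqnn n)).
move/rdist_cvgP: s_v => /(_ _ e4) s_v; move/rdist_cvgP: t_w => /(_ _ e4) t_w.
apply: filterS (filterI (filterI (close _ s_f) (close _ t_f))
  (filterI s_v t_w)).
move=> n [[sn tn] [s_vn t_wn]].
have := simple_integral_dist (simple_s n).1 (simple_t n).1 (simple_s n).2
  (simple_t n).2.
have : (L1_norm mu (fun x => s n x - t n x)%R <=
    L1_norm mu (fun x => f x - s n x)%R +
    L1_norm mu (fun x => f x - t n x)%R)%E.
  rewrite /L1_norm -ge0_integralD//; last 4 first.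
  - by move=> x _; rewrite lee_fin rnorm_ge0.
  - exact/measurable_EFinP/strongly_measurable_dist/(simple_s n).1.
  - by move=> x _; rewrite lee_fin rnorm_ge0.
  - exact/measurable_EFinP/strongly_measurable_dist/(simple_t n).1.
  apply: ge0_le_integral => //.
  - by move=> x _; rewrite lee_fin rnorm_ge0.
  - apply/measurable_EFinP/strongly_measurable_dist; last exact: (simple_t n).1.
    exists (fun=> s n); split=> [_|x]; last exact: cvg_cst.
    exact: (simple_s n).1.
  - by apply: emeasurable_funD;
      apply/measurable_EFinP/strongly_measurable_dist => //;
      [exact: (simple_s n).1|exact: (simple_t n).1].
  - move=> x _; rewrite -EFinD lee_fin rdistC.
    have := rdist_triangle (t n x) (f x) (s n x).
    by rewrite (rdistC (t n x) (f x)) addrC (addrC (rnorm _)).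
move=> /[swap]/le_trans/[apply]/le_lt_trans/(_ (lteD sn tn)).
rewrite -EFinD lte_fin.
have := rdist_triangle v (simple_integral mu (s n)) w.
have := rdist_triangle (simple_integral mu (s n)) (simple_integral mu (t n)) w.
by rewrite (rdistC v (simple_integral mu (s n))); lra.
Qed.

Lemma L1_norm_isometry u f : L1_norm mu (u \o f) = L1_norm mu f.
Proof. by apply: eq_integral => x _; rewrite /rnorm /= iso_norm. Qed.

Lemma simple_integral_isometry u s :
  simple_function s -> (L1_norm mu s < +oo)%E ->
  simple_integral mu (u \o s) = u (simple_integral mu s).
Proof.
move=> simple_s s_int; rewrite simple_integral_comp; last 3 first.
- exact: simple_s.1.
- exact: simple_s.2.
- move=> v; apply: simple_measure_fin; first exact: simple_function_comp.
  by rewrite L1_norm_isometry.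
rewrite /simple_integral !fsbig_finite//=; [|exact: simple_s.1..].
have uD v w : u (v + w) = u v + u w.
  by have := iso_linear u 1 v w; rewrite !scale1r.
have u0 : u 0 = 0 by apply: (addrI (u 0)); rewrite -uD !addr0.
have uZ k v : u (k *: v) = k *: u v.
  by rewrite -[k *: v]addr0 iso_linear u0 addr0.
by rewrite (big_morph u uD u0); apply: eq_bigr => v _; rewrite uZ.
Qed.

Lemma strongly_measurable_isometry u f :
  strongly_measurable f -> strongly_measurable (u \o f).
Proof.
move=> [s [simple_s s_f]]; exists (fun n => u \o s n); split=> [n|x].
  exact: simple_function_comp.
apply: continuous_cvg (s_f x).
exact/bounded_linear_continuous/bounded_linear_iso.
Qed.

Lemma bochner_integral_isometry_is u f v :
  is_bochner_integral mu f v -> is_bochner_integral mu (u \o f) (u v).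
Proof.
have bu := bounded_linear_iso u.
move=> [s [simple_s s_f s_v]]; exists (fun n => u \o s n); split=> [n||].
- by rewrite L1_norm_isometry; split; [exact/simple_function_comp/(simple_s n).1
    |exact: (simple_s n).2].
- apply: cvg_trans s_f; apply: near_eq_cvg; apply: nearW => n.
  rewrite -(L1_norm_isometry u); congr L1_norm.
  by apply/funext => x; rewrite /= bounded_linearB.
- rewrite (_ : (fun n => _) = u \o (fun n => simple_integral mu (s n))).
    by apply: continuous_cvg s_v; exact: bounded_linear_continuous.
  by apply/funext => n /=; rewrite simple_integral_isometry//;
    [exact: (simple_s n).1|exact: (simple_s n).2].
Qed.

(* The left inverse [u'] makes this true also when [f] is not integrable: then
   neither is [u \o f], and both sides are 0. *)
Lemma bochner_integral_isometry u u' f : cancel u u' ->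
  bochner_integral mu (u \o f) = u (bochner_integral mu f).
Proof.
move=> uK; have bu := bounded_linear_iso u.
have u'f : u' \o (u \o f) = f by apply/funext => x /=; rewrite uK.
have [[v [f_int fv]]|no_v] :=
    pselect (exists v, bochner_integrable mu f /\ is_bochner_integral mu f v).
  have uf_int : bochner_integrable mu (u \o f).
    by case: f_int => fm fint; split; [exact: strongly_measurable_isometry|
      rewrite L1_norm_isometry].
  have fP := xgetPex 0 (ex_intro (fun v => bochner_integrable mu f /\
    is_bochner_integral mu f v) v (conj f_int fv)).
  rewrite /bochner_integral; apply: xget_unique.
    by split=> //; apply: bochner_integral_isometry_is; exact: fP.2.
  move=> w [_ ufw]; apply: (bochner_integral_uniq uf_int.1 ufw).
  by apply: bochner_integral_isometry_is; exact: fP.2.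
have u0 : u 0 = 0 by have := bounded_linearB 0 0 bu; rewrite !subrr.
rewrite /bochner_integral !xgetPN ?u0// => v [f_int fv]; apply: no_v.
  by exists v.
exists (u' v); rewrite -u'f; split; last first.
  exact: bochner_integral_isometry_is.
case: f_int => ufm ufint; split; first exact: strongly_measurable_isometry.
by rewrite L1_norm_isometry.
Qed.

Lemma strongly_measurable_rnorm f :
  strongly_measurable f -> measurable_fun setT (fun x => (rnorm (f x))%:E).
Proof.
move=> fm; apply/measurable_EFinP.
have simple0 : simple_function (fun _ : T => 0 : E).
  split=> [|v]; last by rewrite preimage_cst; case: ifP.
  by apply: (sub_finite_set (B := [set 0])) => // _ [x _ <-].
rewrite (_ : (fun x => _) = fun x => rnorm (f x - 0)).
  exact: strongly_measurable_dist.
by apply/funext => x; rewrite subr0.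
Qed.

Lemma bochner_integrable_linear (k : R[i]) f g :
  bochner_integrable mu f -> bochner_integrable mu g ->
  bochner_integrable mu (fun x => k *: f x + g x).
Proof.
move=> [fm f_int] [gm g_int].
have km : strongly_measurable (fun x => k *: f x + g x).
  move: fm gm => [s [simple_s s_f]] [t [simple_t t_g]].
  exists (fun n x => k *: s n x + t n x); split=> [n|x].
    exact: (simple_function_comp2 (fun v w => k *: v + w)).
  by apply: cvgD (t_g x); apply: cvgZr; exact: s_f.
split=> //.
have kf_ge0 : 0 <= complex.Re `|k|.
  by have := normr_ge0 k; rewrite lecE => /andP[].
apply: (@le_lt_trans _ _
  ((complex.Re `|k|)%:E * L1_norm mu f + L1_norm mu g)%E).
  rewrite /L1_norm -ge0_integralZl_EFin//; last 2 first.
  - by move=> x _; rewrite lee_fin rnorm_ge0.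
  - exact: strongly_measurable_rnorm.
  rewrite -ge0_integralD//; last 4 first.
  - by move=> x _; rewrite mule_ge0// lee_fin rnorm_ge0.
  - by apply: measurable_funeM; exact: strongly_measurable_rnorm.
  - by move=> x _; rewrite lee_fin rnorm_ge0.
  - exact: strongly_measurable_rnorm.
  apply: ge0_le_integral => //.
  - by move=> x _; rewrite lee_fin rnorm_ge0.
  - exact: strongly_measurable_rnorm.
  - apply: emeasurable_funD; last exact: strongly_measurable_rnorm.
    by apply: measurable_funeM; exact: strongly_measurable_rnorm.
  - by move=> x _; rewrite -EFinM -EFinD lee_fin -rnormZ rnormD.
by rewrite lte_add_pinfty// lte_mul_pinfty// fin_numE.
Qed.

End BochnerIntegral.

(** * Strong measurability *)

Fixpoint first_argmin {R : realType} (a : nat -> R) (n : nat) : nat :=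
  if n is n'.+1 then
    if a n < a (first_argmin a n') then n else first_argmin a n'
  else 0%N.

Lemma first_argmin_le {R : realType} (a : nat -> R) n :
  (first_argmin a n <= n)%N.
Proof. by elim: n => //= n IH; case: ifP => // _; exact: leqW. Qed.

Lemma first_argminS {R : realType} (a : nat -> R) n :
  a (first_argmin a n.+1) = Num.min (a n.+1) (a (first_argmin a n)).
Proof. by rewrite /= minElt; case: ifP. Qed.

Lemma first_argmin_min {R : realType} (a : nat -> R) n k : (k <= n)%N ->
  a (first_argmin a n) <= a k.
Proof.
elim: n => [|n IH]; first by rewrite leqn0 => /eqP ->.
rewrite first_argminS ge_min leq_eqVlt => /predU1P[->|]; first by rewrite lexx.
by rewrite ltnS => /IH ->; rewrite orbT.
Qed.

Section StrongMeasurability.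
Context {R : realType} {E : normedModType R[i]}.

(** A criterion of Pettis type, with distances in place of functionals. The n-th approximant takes
    the first nearest point among the first n + 1 points of an enumeration of [D]; comparisons of
    measurable distances make the choice measurable, and density makes it converge. *)
Lemma dist_strongly_measurable d {T : measurableType d} (h : T -> E)
    (D : set E) :
  countable D -> range h `<=` closure D ->
  (forall v, D v -> measurable_fun setT (fun x => rnorm (h x - v))) ->
  strongly_measurable h.
Proof.
(* [D] cannot be empty, since [T] is pointed and the range of [h] lies in the closure of [D]. *)
move=> /pfcard_geP[D0|[c]] hD D_meas.
  have : closure D (h point) by apply: hD; exists point.
  by rewrite D0 closure0.
have cD n : D (c n) by exact: funS.
pose m n x := first_argmin (fun k => rnorm (h x - c k)) n.
have m_dist_meas n : measurable_fun setT (fun x => rnorm (h x - c (m n x))).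
  elim: n => [|n IH]; first exact: (D_meas _ (cD _)).
  under eq_fun do rewrite /m (first_argminS (fun k => rnorm (h _ - c k))).
  by apply: measurable_minr; [exact: (D_meas _ (cD _))|exact: IH].
have m_meas n : measurable_fun setT (m n).
  elim: n => [|n IH]; first exact: measurable_cst.
  apply: measurable_fun_ifT; [|exact: measurable_cst|exact: IH].
  by apply: measurable_fun_ltr; [exact: (D_meas _ (cD _))|exact: m_dist_meas].
exists (fun n => c \o m n); split=> [n|x].
  have m_fin : finite_set (range (m n)).
    apply: (sub_finite_set (B := `I_n.+1)); last exact: finite_II.
    by move=> _ [x _ <-] /=; rewrite ltnS first_argmin_le.
  have m_fib j : measurable (m n @^-1` [set j]).
    by rewrite -[_ @^-1` _]setTI; exact: m_meas.
  split; first by rewrite -(image_comp (m n) c); apply: finite_image.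
  by move=> v; exact: (finite_range_preimage m_fin m_fib (c @^-1` [set v])).
apply/rdist_cvgP => e e0.
have /closure_rdistP/(_ _ e0)[_ /(surj (f := c))[k _ <-] hk] : closure D (h x).
  by apply: hD; exists x.
exists k => // n /= kn; rewrite rdistC;
exact: le_lt_trans (first_argmin_min (fun k => rnorm (h x - c k)) kn) hk.
Qed.

Lemma borel_continuous_measurable (G : ptopologicalType) (f : G -> R) :
  continuous f -> measurable_fun setT (f : borel G -> R).
Proof.
move=> /continuousP cf; apply: (measurability _ (RGenOpens.measurableE R)).
move=> _ [_ [a [b ->] <-]]; rewrite setTI.
by apply: sub_sigma_algebra; apply: cf; exact: interval_open.
Qed.

(** One point is picked in each basic open set; for an empty one the choice falls on [point]. *)
Lemma second_countable_dense (G : ptopologicalType) : @second_countable G ->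
  exists2 D : set G, countable D &
    forall U, open U -> U !=set0 -> D `&` U !=set0.
Proof.
move=> [B B_count [_ B_basis]].
exists (\bigcup_(U in B) [set xget point U]).
  by apply: bigcup_countable => // U _; exact: countable1.
move=> U oU [x Ux].
have [V [BV Vx] VU] := B_basis x U (open_nbhs_nbhs (conj oU Ux)).
exists (xget point V); split; first by exists V.
by apply: VU; exact: xgetPex (ex_intro _ x Vx).
Qed.

(** The functions [W x (s n x)] converge to [W x (f x)] but need not be simple. The distance
    criterion is applied to the countable set of all [W g v], with [g] in a dense sequence and [v] a
    value of some [s n]. *)
Lemma strongly_measurable_twist (G : ptopologicalType) (W : G -> E -> E)
    (f : G -> E) :
  @second_countable G ->
  (forall x v w, rnorm (W x v - W x w) = rnorm (v - w)) ->
  (forall v, continuous (W^~ v)) ->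
  strongly_measurable (f : borel G -> E) ->
  strongly_measurable ((fun x => W x (f x)) : borel G -> E).
Proof.
move=> /second_countable_dense[Q Q_count Q_dense] W_isom W_cont.
move=> [s [simple_s s_f]].
apply: (@dist_strongly_measurable _ _ _
  (\bigcup_(g in Q) \bigcup_n \bigcup_(v in range (s n)) [set W g v])).
- apply: bigcup_countable => // g _; apply: bigcup_countable => // n _.
  apply: bigcup_countable => [|v _]; last exact: countable1.
  exact/finite_set_countable/(simple_s n).1.
- move=> _ [x _ <-]; apply/closure_rdistP => e e0.
  have e2 : 0 < e / 2 by rewrite divr_gt0.
  have /rdist_cvgP/(_ _ e2)[n _ /(_ n (leqnn n)) /= sn] := s_f x.
  have /rdist_cvgP/(_ _ e2) Wx := W_cont (s n x) x.
  (* With the vector [s n x] fixed, strong continuity allows [x] to be replaced by a nearby point of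
     [Q]. *)
  have [g [Qg /interior_subset /= gx]] : Q `&` (fun g =>
      rnorm (W g (s n x) - W x (s n x)) < e / 2)° !=set0.
    by apply: Q_dense; [exact: open_interior|exists x].
  exists (W g (s n x)).
    by exists g => //; exists n => //; exists (s n x) => //; exists x.
  apply: le_lt_trans (rdist_triangle _ (W x (s n x)) _) _.
  rewrite W_isom (rdistC (f x)) (rdistC (W x _)); lra.
- move=> w _; apply: (measurable_fun_cvg (h := fun n (x : borel G) =>
    rnorm (W x (s n x) - w))).
    move=> n _ Y mY; rewrite setTI.
    (* On each of the finitely many fibres of [s n] the vector is constant, and the distance is
       continuous in x. *)
    rewrite (_ : _ @^-1` _ = \bigcup_(v in range (s n)) (s n @^-1` [set v] `&`
        (fun x => rnorm (W x v - w)) @^-1` Y)).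
      apply: fin_bigcup_measurable; first exact: (simple_s n).1.
      move=> v _; apply: measurableI; first exact: (simple_s n).2.
      rewrite -[X in measurable X]setTI.
      apply: borel_continuous_measurable => //.
      move=> x; apply/cvgrPdist_lt => e e0.
      have /rdist_cvgP/(_ _ e0) := W_cont v x; apply: filterS => y.
      apply: le_lt_trans; apply: le_trans (rdist_dist _ _ _) _.
      by rewrite rdistC.
    apply/seteqP; split=> [x Yx|x [v _ [/= <-]]//].
    by exists (s n x) => //; exists x.
  move=> x _; apply/cvgrPdist_lt => e e0.
  have /rdist_cvgP/(_ _ e0) := s_f x; apply: filterS => n.
  apply: le_lt_trans; apply: le_trans (rdist_dist _ _ _) _.
  by rewrite W_isom rdistC.
Qed.

End StrongMeasurability.

(** * Exterior equivalence *)

Section ExteriorEquivalence.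
Context {R : realType} {G : topGroupType} {A : banachAlgType R[i]}.
Implicit Types (s t : twisted_action G A) (theta : G -> inv1 A).

Definition exterior_by theta s t : Prop :=
  [/\ (forall a, continuous (fun x => lmul (theta x) a)),
      (forall a, continuous (fun x => rmul (theta x) a)),
      (forall x a, ta_alpha t x a = Ad (theta x) (ta_alpha s x a)) &
      (forall x y,
         mult_mul (ta_sigma t x y) (theta (x * y)%g) =
         mult_mul (mult_mul (theta x) (aut_mult (ta_alpha s x) (theta y)))
                  (ta_sigma s x y))].

Definition twist theta (f : G -> A) (x : G) : A :=
  rmul (inv1_inv (theta x)) (f x).

Lemma twistK theta : cancel (twist theta) (twist (fun x => inv1V (theta x))).
Proof. by move=> f; apply/funext => x; rewrite /twist /= rmulVK. Qed.

Lemma twistVK theta : cancel (twist (fun x => inv1V (theta x))) (twist theta).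
Proof. by move=> f; apply/funext => x; rewrite /twist /= rmulK. Qed.

(** With b = theta_x^{-1} a fixed, the isometry theta_y turns the distance of theta_y^{-1} a and
    theta_x^{-1} a into that of theta_x b and theta_y b. The action is abstract to cover both sides
    of multiplication. *)
Lemma inv1V_continuous theta (act : multiplier A -> A -> A) :
  (forall m a b, act m (a - b) = act m a - act m b) ->
  (forall (u : inv1 A), cancel (act u) (act (inv1_inv u))) ->
  (forall (u : inv1 A), cancel (act (inv1_inv u)) (act u)) ->
  (forall (u : inv1 A) a, rnorm (act u a) = rnorm a) ->
  (forall a, continuous (fun x => act (theta x) a)) ->
  forall a, continuous (fun x => act (inv1_inv (theta x)) a).
Proof.
move=> actB actK actVK act_isom cont a x; apply/rdist_cvgP => e e0.
have /rdist_cvgP/(_ _ e0) := cont (act (inv1_inv (theta x)) a) x.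
apply: filterS => y; apply: le_lt_trans.
by rewrite -(act_isom (theta y)) actB !actVK rdistC.
Qed.

Lemma rmulB (m : multiplier A) a b : rmul m (a - b) = rmul m a - rmul m b.
Proof. exact: bounded_linearB (rmul_bounded_linear m). Qed.

Lemma lmulB (m : multiplier A) a b : lmul m (a - b) = lmul m a - lmul m b.
Proof. exact: bounded_linearB (lmul_bounded_linear m). Qed.

Lemma exterior_by_rmul theta s t x y a : exterior_by theta s t ->
  rmul (theta (x * y)%g) (rmul (ta_sigma t x y) a) =
  rmul (ta_sigma s x y)
    (rmul (aut_mult (ta_alpha s x) (theta y)) (rmul (theta x) a)).
Proof. by case=> _ _ _ /(_ x y)/(congr1 (@rmul _ A ^~ a)). Qed.

Lemma exterior_by_lmul theta s t x y a : exterior_by theta s t ->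
  lmul (ta_sigma t x y) (lmul (theta (x * y)%g) a) =
  lmul (theta x)
    (lmul (aut_mult (ta_alpha s x) (theta y)) (lmul (ta_sigma s x y) a)).
Proof. by case=> _ _ _ /(_ x y)/(congr1 (@lmul _ A ^~ a)). Qed.

Lemma Ad_invV (u : inv1 A) : has_cai A -> cancel (Ad u) (Ad (inv1V u)).
Proof.
by move=> cai a; rewrite /Ad /= lmul_rmulC// lmulK rmulVK.
Qed.

(** Since beta_x = Ad(theta_x) alpha_x, one has theta_x^{-1} beta_x(theta_y^{-1}) =
    alpha_x(theta_y)^{-1} theta_x^{-1}. The new cocycle relation is therefore the old one multiplied
    by inverses on both sides. *)
Lemma exterior_by_sym theta s t : has_cai A ->
  exterior_by theta s t -> exterior_by (fun x => inv1V (theta x)) t s.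
Proof.
move=> cai st; have [cl cr Ad_st _] := st; split=> [a|a|x a|x y].
- apply: (inv1V_continuous (act := @lmul _ A)) => //.
  + exact: lmulB.
  + exact: lmulK.
  + exact: lmulVK.
  + exact: rnorm_lmul_inv1.
- apply: (inv1V_continuous (act := @rmul _ A)) => //.
  + exact: rmulB.
  + exact: rmulK.
  + exact: rmulVK.
  + exact: rnorm_rmul_inv1.
- by rewrite Ad_st Ad_invV.
(* The extension of beta_x to M(A) involves beta_x^{-1}, which is rewritten as alpha_x^{-1}
   Ad(theta_x^{-1}). *)
have Ad_st_inv a : iso_inv (ta_alpha t x) a =
    iso_inv (ta_alpha s x) (Ad (inv1V (theta x)) a).
  apply: (can_inj (isoK (ta_alpha t x))); rewrite isoVK Ad_st isoVK.
  exact/esym/(Ad_invV (inv1V (theta x)) cai a).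
pose N := aut_mult (ta_alpha s x) (theta y).
pose M := aut_mult (ta_alpha s x) (inv1_inv (theta y)).
have Ml b : ta_alpha s x (lmul (inv1_inv (theta y))
    (iso_inv (ta_alpha s x) b)) = lmul M b by [].
have Mr b : ta_alpha s x (rmul (inv1_inv (theta y))
    (iso_inv (ta_alpha s x) b)) = rmul M b by [].
have MlK : cancel (lmul N) (lmul M) by exact: aut_lmulK.
have MrVK : cancel (rmul M) (rmul N) by exact: aut_rmulVK.
have NlE a : lmul (ta_sigma t x y) (lmul (theta (x * y)%g) a) =
    lmul (theta x) (lmul N (lmul (ta_sigma s x y) a)) :=
  exterior_by_lmul _ _ _ st.
have NrE a : rmul (theta (x * y)%g) (rmul (ta_sigma t x y) a) =
    rmul (ta_sigma s x y) (rmul N (rmul (theta x) a)) :=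
  exterior_by_rmul _ _ _ st.
have AdV u (a : A) : Ad (inv1V u) a = rmul u (lmul (inv1_inv u) a) by [].
clearbody M N; apply: multiplier_eq => a /=; rewrite Ad_st_inv Ad_st AdV.
- rewrite Ml /Ad lmul_rmulC// lmulK -lmul_rmulC// rmulK.
  by rewrite -{2}[a](lmulVK (theta (x * y)%g)) NlE lmulK MlK.
- rewrite Mr /Ad !lmul_rmulC// rmulVK lmulVK.
  by apply: (can_inj (rmulK (theta (x * y)%g))); rewrite rmulVK NrE rmulVK MrVK.
Qed.

End ExteriorEquivalence.

(** * Crossed products *)

Section CrossedProducts.
Context {R : realType} {G : topGroupType} {A : banachAlgType R[i]}.
Variables (cai : has_cai A) (G_sc : @second_countable G)
  (mu : {measure set (borel G) -> \bar R}).
Implicit Types (s t : twisted_action G A) (theta : G -> inv1 A).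

Definition rmul_isometry (u : inv1 A) : lin_isometry A.
Proof.
refine (@LinIsometry _ _ (rmul u) (rmul (inv1_inv u)) (rmulK u) (rmulVK u)
  (rmul_bounded_linear u).1 _).
by move=> a; rewrite !rnormE rnorm_rmul_inv1.
Defined.

Lemma L1_twist theta s t f : exterior_by theta s t ->
  L1 mu f -> L1 mu (twist theta f).
Proof.
move=> st [f_meas f_int]; split.
  apply: (strongly_measurable_twist
    (W := fun x => rmul (inv1_inv (theta x)))) => //.
    by move=> x v w; rewrite -rmulB (rnorm_rmul_inv1 (inv1V (theta x))).
  by have [_ cr' _ _] := exterior_by_sym cai st.
rewrite /L1_norm (eq_integral (fun x : borel G => (rnorm (f x))%:E))// => x _.
by rewrite /twist (rnorm_rmul_inv1 (inv1V (theta x))).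
Qed.

(** For fixed x, right multiplication by theta_x^{-1} is an invertible isometry and passes under the
    integral; the integrands are then equal for every y. *)
Lemma twist_conv theta s t f g : exterior_by theta s t ->
  twist theta (twisted_conv mu s f g) =
  twisted_conv mu t (twist theta f) (twist theta g).
Proof.
move=> st; have [_ _ Ad_st _] := st; apply/funext => x.
rewrite /twist /twisted_conv.
rewrite -[LHS](bochner_integral_isometry (u := rmul_isometry (inv1V (theta x)))
  (u' := rmul_isometry (theta x)) mu _ (rmulVK _)).
congr bochner_integral; apply/funext => y /=.
set z := (y^-1 * x)%g; have -> : x = (y * z)%g by rewrite /z mulVKg.
(* beta_y(g(z) theta_z^{-1}) starts with theta_y, which cancels the theta_y^{-1} next to f(y). *)
have -> : bmul (rmul (inv1_inv (theta y)) (f y))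
      (ta_alpha t y (rmul (inv1_inv (theta z)) (g z))) =
    rmul (inv1_inv (theta y))
      (rmul (aut_mult (ta_alpha s y) (inv1_inv (theta z)))
        (bmul (f y) (ta_alpha s y (g z)))).
  by rewrite Ad_st /Ad aut_rmul -rmul_bmul mul_balanced rmulVK -rmul_bmul.
apply: (can_inj (rmulK (theta (y * z)%g))).
by rewrite rmulVK (exterior_by_rmul _ _ _ st) rmulVK aut_rmulVK.
Qed.

(** [pi] and its extension are kept, so only the new isometries need work: their product rule rests
    on covariance extended to M(A), their continuity on strict continuity of [theta]. *)
Lemma exterior_covariant_rep theta s t (E : normedModType R[i])
    (c : covariant_rep s E) : exterior_by theta s t -> contractive (cov_pi c) ->
  exists c' : covariant_rep t E, cov_pi c' = cov_pi c /\
    forall x v, cov_u c' x v = cov_hat c (theta x) (cov_u c x v).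
Proof.
move=> st pi_contr; have [cl cr Ad_st _] := st.
have pi_nondeg := cov_nondegenerate c.
set hat := cov_hat c; set pi := cov_pi c.
have hatK u v : hat (inv1_inv u) (hat u v) = v.
  by rewrite -ext_mul inv1_Vmul ext_one.
have hatVK (u : inv1 A) v : hat u (hat (inv1_inv u) v) = v := hatK (inv1V u) v.
have hat_norm (u : inv1 A) v : rnorm (hat u v) = rnorm v.
  have le (w : inv1 A) v' : rnorm (hat w v') <= rnorm v'.
    have := rnorm_ext cai pi_nondeg pi_contr hat w v'.
    by rewrite inv1_norm mul1r.
  apply/eqP; rewrite eq_le le -{1}[v](hatK u).
  exact: (le (inv1V u)).
have hat_lin m : linear (hat m) := (ext_bounded_linear hat m).1.
(* Covariance for multipliers: both sides are bounded operators in [v] and agree on the vectors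
   pi(a)w. *)
have hat_aut m x v : hat (aut_mult (ta_alpha s x) m) (cov_u c x v) =
    cov_u c x (hat m v).
  have := eq_on_range cai pi_nondeg pi_contr
    (f := fun v => hat (aut_mult (ta_alpha s x) m) (cov_u c x v))
    (g := fun v => cov_u c x (hat m v)).
  apply.
  - apply: bounded_linear_comp (bounded_linear_iso _).
    exact: ext_bounded_linear.
  - exact: bounded_linear_comp (bounded_linear_iso _) (ext_bounded_linear _ _).
  - move=> a w; have E1 b z : cov_u c x (pi b z) =
        pi (ta_alpha s x b) (cov_u c x z) by rewrite cov_piu isoK.
    by rewrite E1 ext_lmul ext_lmul E1 aut_lmul.
have vK x : cancel (fun v => hat (theta x) (cov_u c x v))
    (fun v => iso_inv (cov_u c x) (hat (inv1_inv (theta x)) v)).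
  by move=> v; rewrite hatK isoK.
have vVK x : cancel (fun v => iso_inv (cov_u c x) (hat (inv1_inv (theta x)) v))
    (fun v => hat (theta x) (cov_u c x v)).
  by move=> v; rewrite isoVK hatVK.
have v_lin x : linear (fun v => hat (theta x) (cov_u c x v)).
  by move=> k v w; rewrite iso_linear hat_lin.
have v_norm x v : `|hat (theta x) (cov_u c x v)| = `|v|.
  by rewrite rnormE hat_norm -rnormE iso_norm.
pose v x := LinIsometry (vK x) (vVK x) (v_lin x) (v_norm x).
unshelve eexists (@CovariantRep _ _ _ t E pi hat v pi_nondeg _ _ _).
(* [hat (theta g) w'] is replaced by [pi (lmul (theta g) a) w'], with an error uniform in g because
   [hat (theta g)] is isometric. The four quarters are this error at x and at y, the variation of
   [theta] on [a], and that of [cov_u] on [w]. *)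
- move=> w x; apply/rdist_cvgP => e e0.
  have e4 : 0 < e / 4 by rewrite divr_gt0.
  have [a [_ aw]] := cai_approx cai pi_nondeg pi_contr (cov_u c x w) e4.
  set w' := cov_u c x w in aw *.
  have nw : 0 < rnorm w' + 1 by rewrite ltr_wpDl ?rnorm_ge0.
  have /rdist_cvgP/(_ _ e4) u_cont := @cov_u_continuous _ _ _ _ _ c w x.
  have /rdist_cvgP/(_ _ (divr_gt0 e4 nw)) := cl a x.
  move: u_cont; apply: filterS2 => y yw ya /=; rewrite -/w'.
  have approx g : rnorm (hat (theta g) w' - pi (lmul (theta g) a) w') < e / 4.
    rewrite -(ext_lmul hat) -(bounded_linearB _ _ (ext_bounded_linear hat _)).
    by rewrite hat_norm.
  have close :
      rnorm (pi (lmul (theta y) a) w' - pi (lmul (theta x) a) w') < e / 4.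
    rewrite -repB; apply: le_lt_trans (rnorm_rep pi_contr _ _) _.
    rewrite ltr_pdivlMr// in ya; apply: le_lt_trans ya.
    by rewrite ler_wpM2l ?rnorm_ge0// lerDl.
  have : rnorm (hat (theta y) (cov_u c y w) - hat (theta y) w') < e / 4.
    by rewrite -(bounded_linearB _ _ (ext_bounded_linear hat _)) hat_norm.
  have := rdist_triangle (hat (theta y) (cov_u c y w)) (hat (theta y) w')
    (hat (theta x) w').
  have := rdist_triangle (hat (theta y) w') (pi (lmul (theta y) a) w')
    (hat (theta x) w').
  have := rdist_triangle (pi (lmul (theta y) a) w') (pi (lmul (theta x) a) w')
    (hat (theta x) w').
  have := approx y; have := approx x.
  by rewrite (rdistC (hat (theta x) w')); lra.
- move=> x y w /=.
  rewrite -hat_aut cov_uM -!ext_mul.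
  by have [_ _ _ <-] := st; rewrite ext_mul.
- move=> x a w /=.
  rewrite Ad_st /Ad -(ext_rmul hat) -(ext_lmul hat) cov_piu.
  by [].
by [].
Qed.

(** The two suprema run over the same set of reals. One inclusion is proved for every equivalence;
    the other is its instance for the inverse equivalence and the twisted function. *)
Lemma Fp_seminorm_twist p theta s t f : exterior_by theta s t ->
  Fp_seminorm p mu t (twist theta f) = Fp_seminorm p mu s f.
Proof.
move=> st; rewrite /Fp_seminorm; congr sup.
have sub theta' s' t' f' r : exterior_by theta' s' t' ->
    (exists (E : normedModType R[i]) (c : covariant_rep s' E),
    [/\ sigma_finite_Lp_space p E, contractive (cov_pi c) &
        r = opnorm (integrated_form mu c f')]) ->
    (exists (E : normedModType R[i]) (c : covariant_rep t' E),
    [/\ sigma_finite_Lp_space p E, contractive (cov_pi c) &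
        r = opnorm (integrated_form mu c (twist theta' f'))]).
  move=> st' [E [c [E_Lp c_contr ->]]].
  have [c' [c'pi c'u]] := exterior_covariant_rep st' c_contr.
  exists E, c'; split; [exact: E_Lp|by rewrite c'pi|].
  suff -> : integrated_form mu c' (twist theta' f') =
    integrated_form mu c f' by [].
  apply/funext => v; rewrite /integrated_form; congr bochner_integral.
  apply/funext => x; rewrite c'pi c'u /twist ext_rmul; congr (cov_pi c _ _).
  by rewrite rmulVK.
apply/seteqP; split=> r; last exact: sub.
by move=> /(sub _ _ _ _ _ (exterior_by_sym cai st)); rewrite twistK.
Qed.

End CrossedProducts.

Theorem corollary6p5 (R : realType) (p : R) (p_ge1 : 1 <= p)
    (A : banachAlgType R[i]) (A_Lp : nondegenerate_Lp_operator_algebra p A)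
    (A_cai : has_cai A)
    (G : topGroupType) (G_hausdorff : hausdorff_space G)
    (G_lc : locally_compact [set: G]) (G_sc : @second_countable G)
    (mu : {measure set (borel G) -> \bar R}) (mu_haar : left_haar mu)
    (alpha_sigma beta_omega : twisted_action G A)
    (ext_equiv : exterior_equivalent alpha_sigma beta_omega)
    (F1 F2 : banachAlgType R[i])
    (iota1 : (G -> A) -> F1) (iota2 : (G -> A) -> F2)
    (F1_crossed : is_full_crossed_product p mu alpha_sigma iota1)
    (F2_crossed : is_full_crossed_product p mu beta_omega iota2) :
  isometrically_isomorphic F1 F2.
Proof.
have [theta st] : exists theta, exterior_by theta alpha_sigma beta_omega :=
  ext_equiv.
have ts := exterior_by_sym A_cai st.
have L1T f : L1 mu f -> L1 mu (twist theta f) := L1_twist A_cai G_sc st.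
have twist_lin k f g : twist theta (fun x => k *: f x + g x) =
    (fun x => k *: twist theta f x + twist theta g x).
  by apply/funext => x; rewrite /twist (rmul_bounded_linear _).1.
apply: (isometric_completions (L := L1 mu) (j1 := iota1)
  (j2 := iota2 \o twist theta)
  (add := fun k f g x => k *: f x + g x) (mul := twisted_conv mu alpha_sigma)).
- by move=> k f g; exact: bochner_integrable_linear.
- by move=> f g Lf Lg; have [] := fcp_mul F1_crossed Lf Lg.
- exact: fcp_linear F1_crossed.
- move=> k f g Lf Lg; rewrite /= twist_lin.
  by apply: (fcp_linear F2_crossed); exact: L1T.
- by move=> f g Lf Lg; have [] := fcp_mul F1_crossed Lf Lg.
- move=> f g Lf Lg; rewrite /= (twist_conv mu _ _ st).
  by have [] := fcp_mul F2_crossed (L1T _ Lf) (L1T _ Lg).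
- move=> f Lf.
  rewrite /= (fcp_norm F1_crossed Lf) (fcp_norm F2_crossed (L1T _ Lf)).
  by rewrite (Fp_seminorm_twist A_cai _ _ _ st).
- exact: fcp_dense F1_crossed.
(* T maps [L1] onto itself, so composing with it does not change the image of [iota2]. *)
- rewrite -(fcp_dense F2_crossed); congr closure.
  apply/seteqP; split=> _ [f Lf <-].
    by exists (twist theta f) => //; exact: L1T.
  exists (twist (fun x => inv1V (theta x)) f).
    exact: (L1_twist A_cai G_sc ts Lf).
  by rewrite /= twistVK.
Qed.
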